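(* Let $\mathbf p=(p_1,\dots,p_n)$ with $p_i\in(1,\infty)$, let $1\le j\le n$, $s_{j+1},\dots,s_n\in(0,1)$ fixed, and for $k\in\mathbb N$ let $\mathbf s_k=(s^k_1,\dots,s^k_j,s_{j+1},\dots,s_n)$ with $s^k_i\in(0,1)$ and $s^k_i\to1$ as $k\to\infty$ for $i=1,\dots,j$, so that $\mathbf s_k\to\mathbf s_0=(1,\dots,1,s_{j+1},\dots,s_n)$ ($j$ ones). Let $\{u_k\}\subset L^{p_{\min}}(\mathbb R^n)\cap L^{p_{\max}}(\mathbb R^n)$ satisfy $$\sup_k\left(\|u_k\|_{p_{\max}}+\|u_k\|_{p_{\min}}\right)<\infty,\qquad \sup_k J_{\mathbf s_k,\mathbf p}(u_k)<\infty.$$ If $\overline{\mathbf s_0\mathbf p}<n$ and $p_{\max}<\mathbf p^*_{\mathbf s_0}$, then there exist a subsequence $\{u_{k_m}\}_{m\in\mathbb N}$ and a function $u$ such that $u_{k_m}\to u$ in $L^{p_{\max}}_{\mathrm{loc}}(\mathbb R^n)$ as $m\to\infty$.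
   Context: For $i\in\{1,\dots,n\}$, $s\in(0,1]$, $p\in(1,\infty)$, with $e_i$ the $i$-th basis vector: $J^i_{s,p}(u)=s(1-s)\int_{\mathbb R^n}\int_{\mathbb R}\frac{|u(x+he_i)-u(x)|^p}{|h|^{1+sp}}dh\,dx$ if $s<1$, and $J^i_{1,p}(u)=\frac2p\int|\partial_{x_i}u|^p dx$ (distributional derivative; $+\infty$ if not in $L^p$). For $\mathbf s=(s_1,\dots,s_n)\in(0,1]^n$: $J_{\mathbf s,\mathbf p}(u)=\sum_{i=1}^n\frac1{p_i}J^i_{s_i,p_i}(u)$. $p_{\min}=\min_ip_i$, $p_{\max}=\max_ip_i$. $\bar{\mathbf s}=(\frac1n\sum_i1/s_i)^{-1}$, $\overline{\mathbf s\mathbf p}=(\frac1n\sum_i1/(s_ip_i))^{-1}$, and when $\overline{\mathbf s\mathbf p}<n$, $\mathbf p^*_{\mathbf s}=\frac{n\overline{\mathbf s\mathbf p}/\bar{\mathbf s}}{n-\overline{\mathbf s\mathbf p}}$. *)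

(* Defs.v *)
From HB Require Import structures.
From mathcomp Require Import all_boot all_order all_algebra.
From mathcomp Require Import all_classical all_reals all_analysis.
Set Implicit Arguments. Unset Strict Implicit. Unset Printing Implicit Defensive.
Import Order.TTheory GRing.Theory Num.Theory.
Import numFieldNormedType.Exports.
Local Open Scope classical_set_scope.
Local Open Scope ring_scope.

(* R^n is modelled by n.-tuple R, equipped with the library's product
   (= Borel) sigma-algebra on tuples.  x_i = tnth x i (0-based indices). *)

(* Lebesgue integral over R^n of a nonnegative (extended-real valued)
   function, as the iterated one-dimensional Lebesgue integral
   (equal to the integral w.r.t. n-dimensional Lebesgue measure for
   nonnegative measurable integrands, by Tonelli). *)
Fixpoint intRn (R : realType) (n : nat) : (n.-tuple R -> \bar R) -> \bar R :=
  match n return (n.-tuple R -> \bar R) -> \bar R with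
  | 0 => fun f => f [tuple]
  | m.+1 => fun f =>
      (\int[@lebesgue_measure R]_x intRn (fun t : m.-tuple R => f [tuple of x :: t]))%E
  end.

Definition shiftRn (R : realType) (n : nat) (x : n.-tuple R) (i : 'I_n) (h : R)
  : n.-tuple R := [tuple tnth x j + (if j == i then h else 0) | j < n].

Definition pint (R : realType) (n : nat) (p : R) (u : n.-tuple R -> R) : \bar R :=
  intRn (fun x => (`|u x| `^ p)%:E).

Definition Lpnorm (R : realType) (n : nat) (p : R) (u : n.-tuple R -> R) : \bar R :=
  (pint p u `^ p^-1)%E.

Definition Jfrac_i (R : realType) (n : nat) (i : 'I_n) (s p : R)
  (u : n.-tuple R -> R) : \bar R :=
  ((s * (1 - s))%:E *
   intRn (fun x => \int[@lebesgue_measure R]_h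
     ((`|u (shiftRn x i h) - u x| `^ p) / (`|h| `^ (1 + s * p)))%:E))%E.

Definition Jfrac (R : realType) (n : nat) (s p : 'I_n -> R)
  (u : n.-tuple R -> R) : \bar R :=
  (\sum_(i < n) ((p i)^-1)%:E * Jfrac_i i (s i) (p i) u)%E.

Definition pmax (R : realType) (n : nat) (p : 'I_n -> R) : R :=
  \big[Num.max/0]_(i < n) p i.
(* for n >= 1 and p_i > 0 this is min_i p_i *)
Definition pmin (R : realType) (n : nat) (p : 'I_n -> R) : R :=
  \big[Num.min/pmax p]_(i < n) p i.

Definition sbar (R : realType) (n : nat) (s : 'I_n -> R) : R :=
  (n%:R^-1 * \sum_(i < n) (s i)^-1)^-1.
Definition spbar (R : realType) (n : nat) (s p : 'I_n -> R) : R :=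
  (n%:R^-1 * \sum_(i < n) (s i * p i)^-1)^-1.
Definition pstar (R : realType) (n : nat) (s p : 'I_n -> R) : R :=
  (n%:R * spbar s p / sbar s) / (n%:R - spbar s p).

Definition boundedRn (R : realType) (n : nat) (K : set (n.-tuple R)) : Prop :=
  exists r : R, forall x, K x -> forall i, `|tnth x i| <= r.

(* Main.v *)
(** The factor [1 - s] in the Gagliardo energy and the doubling bound
    [G (2h) <= 2^p G h] for [G h = \int |u(x + h e_i) - u(x)|^p dx] give, uniformly
    as [s -> 1], [\int_{l/2}^l G <= p M / s * l^(1 + s p)]; since [l <= 1], the exponents
    [s^k_i] may then be replaced by fixed [sig_i] slightly below [s0_i], still subcritical.
    Comparing [u] with its translates by vectors of the box [prod_i ]l_i/2, l_i]], with
    side lengths [l_i] adapted to the height [la], yields a weak type bound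
    [|{|u| > 2 la}| <= K la^(-q)] for some [q > p_max] and all large [la]; hence the
    powers [|u_k|^p_max] are uniformly integrable.
    On a cube, the same differences show that [u_k] is close in [L^1], uniformly in [k],
    to a step function taking finitely many, uniformly bounded values. A free
    ultrafilter makes all these values converge at once, so that [u_k] is Cauchy in [L^1]
    and, by uniform integrability, in [L^p_max] on every cube along the ultrafilter.
    A diagonal subsequence then converges almost everywhere, and Fatou's lemma concludes. *)

Require Import Defs.
From HB Require Import structures.
From mathcomp Require Import all_boot all_order all_algebra.
From mathcomp Require Import all_classical all_reals all_analysis.
From mathcomp Require Import measurable_realfun zify ring lra.
Import Order.TTheory GRing.Theory Num.Theory.
Import numFieldNormedType.Exports.
Local Open Scope classical_set_scope.
Local Open Scope ring_scope.

Set Implicit Arguments.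
Unset Strict Implicit.
Unset Printing Implicit Defensive.

(** * Lebesgue measure on tuples *)

(** The hypothesis [pmax p < pstar s0 p] acts through one inequality. With P = [pmax p] and A, B the
    sums of 1/(s_i p_i) and 1/s_i for s = [s0], it reads P (A - 1) < B, that is, the sum E of (P -
    p_i)/(s_i p_i) is less than P. For q = P and sig = s0, the box used at height la has volume
    2^(-n) la^(-E), while Chebyshev's inequality bounds the measure of {|u| > la} by N la^(-P),
    where N bounds the integral of |u|^P. So for large la the box is too big to be mostly filled by
    {|u| > la}, and no embedding at the critical exponent is invoked. Being strict, the inequality
    survives the passage to q slightly above P and sig slightly below s0: the first gain makes the
    tails of |u|^P small, the second gives one bound valid for all late k. For each tolerance there
    are finitely many cell values to control, and the tolerance must then go to 0. An ultrafilter
    settles each finite choice without passing to a subsequence, so that the only extraction takes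
    place at the end. *)

Section lebesgue_measure_tuple.
Context {R : realType}.
Local Open Scope ereal_scope.
Implicit Types m n : nat.

Definition consT m (z : measurableTypeR R * m.-tuple R) : m.+1.-tuple R :=
  [tuple of z.1 :: z.2].
Definition unconsT m (x : m.+1.-tuple R) : measurableTypeR R * m.-tuple R :=
  (thead x, [tuple of behead x]).

Lemma measurable_consT m : measurable_fun setT (@consT m).
Proof. exact: (measurable_cons measurable_fst measurable_snd). Qed.

Lemma measurable_unconsT m : measurable_fun setT (@unconsT m).
Proof.
apply: measurable_fun_pair; first exact: measurable_tnth.
apply/measurable_fun_tnthP => i.
rewrite [X in measurable_fun _ X](_ : _ =
  (fun x : m.+1.-tuple R => tnth x (inord i.+1))); last first.
  by apply/funext => x /=; rewrite tnth_behead.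
exact: measurable_tnth.
Qed.

Lemma consTK m : cancel (@consT m) (@unconsT m).
Proof. by case=> a t; rewrite /unconsT/consT/=; congr pair; apply: val_inj. Qed.

Lemma unconsTK m : cancel (@unconsT m) (@consT m).
Proof. by move=> x; rewrite /unconsT/consT/= [RHS]tuple_eta. Qed.

Section lebS.
Variables (m : nat) (mu : {sigma_finite_measure set (m.-tuple R) -> \bar R}).

Definition lebS (A : set (m.+1.-tuple R)) : \bar R :=
  pushforward (@lebesgue_measure R \x mu) (@consT m) A.

Let pf : {measure set (m.+1.-tuple R) -> \bar R} :=
  measure_function_pushforward__canonical__measure_function_Measure (@lebesgue_measure R \x mu)
  (@measurable_consT m).

HB.instance Definition _ := isMeasure.Build _ _ _ lebS
  (@measure0 _ _ _ pf) (@measure_ge0 _ _ _ pf)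
  (@measure_semi_sigma_additive _ _ _ pf).

Let lebS_sigma_finite : sigma_finite setT lebS.
Proof.
have /sigma_finiteP[F [TF ndF Foo]] := sigma_finiteT (@lebesgue_measure R).
have /sigma_finiteP[G [TG ndG Goo]] := sigma_finiteT mu.
exists (fun k => @unconsT m @^-1` (F k `*` G k)).
  rewrite -preimage_bigcup; apply/esym; rewrite -subTset => x _.
  have [i _ Fi] : (\bigcup_i F i) (unconsT x).1 by rewrite -TF.
  have [j _ Gj] : (\bigcup_i G i) (unconsT x).2 by rewrite -TG.
  exists (maxn i j) => //; split.
  - by move: Fi; exact/subsetPset/ndF/leq_maxl.
  - by move: Gj; exact/subsetPset/ndG/leq_maxr.
move=> k; have [mF ?] := Foo k; have [mG ?] := Goo k; split.
  rewrite -[X in measurable X]setTI; apply: measurable_unconsT => //.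
  exact: measurableX.
rewrite /lebS /pushforward -comp_preimage (_ : _ \o _ = id); last first.
  by apply/funext => x /=; rewrite consTK.
by rewrite preimage_id product_measure1E// lte_mul_pinfty// ge0_fin_numE.
Qed.

HB.instance Definition _ := Measure_isSigmaFinite.Build _ _ _ lebS
  lebS_sigma_finite.

Lemma ge0_integral_lebS (f : m.+1.-tuple R -> \bar R) :
  measurable_fun [set: m.+1.-tuple R] f -> (forall x, 0 <= f x) ->
  \int[lebS]_x f x =
  \int[@lebesgue_measure R]_a \int[mu]_t f [tuple of a :: t].
Proof.
move=> mf f0.
transitivity (\int[pf]_x f x).
  by apply: eq_measure_integral => A mA _.
rewrite ge0_integral_pushforward//; last first.
  exact: measurable_consT.
rewrite preimage_setT fubini_tonelli1//.
- by apply: measurableT_comp => //; exact: measurable_consT.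
- by move=> x; exact: f0.
Qed.

End lebS.

(** A genuine measure behind the iterated integral [intRn], so that Tonelli, Fatou and almost
    everywhere statements apply. Sigma-finiteness is carried along because Tonelli needs it at each
    level. *)
Fixpoint lebn n : {sigma_finite_measure set (n.-tuple R) -> \bar R} :=
  match n with
  | 0 => @dirac _ _ [tuple] R
  | m.+1 => lebS (lebn m)
  end.

Lemma intRnE n (f : n.-tuple R -> \bar R) :
  measurable_fun [set: n.-tuple R] f -> (forall x, 0 <= f x) ->
  intRn f = \int[lebn n]_x f x.
Proof.
elim: n f => [|n IH] f mf f0 /=.
  by rewrite integral_dirac// diracT mul1e.
rewrite ge0_integral_lebS//; apply: eq_integral => a _.
rewrite -IH//.
have m1 : measurable_fun [set: n.-tuple R] (fun t => consT (a, t)).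
  exact: (measurable_fun_pair2 a (@measurable_consT n)).
exact: (measurableT_comp mf m1).
Qed.

End lebesgue_measure_tuple.

Section nonnegative_integral.
Context d (T : measurableType d) {R : realType}.
Variable mu : {measure set T -> \bar R}.
Local Open Scope ereal_scope.
Implicit Types f g : T -> \bar R.

Lemma ge0_integralTZl f (k : R) : measurable_fun [set: T] f ->
  (forall x, 0 <= f x) -> (0 <= k)%R ->
  \int[mu]_x (k%:E * f x) = k%:E * \int[mu]_x f x.
Proof. by move=> mf f0 k0; apply: ge0_integralZl. Qed.

Lemma ge0_le_integralT f g :
  measurable_fun [set: T] f -> measurable_fun [set: T] g ->
  (forall x, 0 <= f x) -> (forall x, f x <= g x) ->
  \int[mu]_x f x <= \int[mu]_x g x.
Proof. by move=> mf mg f0 fg; apply: ge0_le_integral. Qed.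

Lemma ge0_integralTD f g :
  measurable_fun [set: T] f -> measurable_fun [set: T] g ->
  (forall x, 0 <= f x) -> (forall x, 0 <= g x) ->
  \int[mu]_x (f x + g x) = \int[mu]_x f x + \int[mu]_x g x.
Proof. by move=> mf mg f0 g0; rewrite ge0_integralD. Qed.

End nonnegative_integral.

(** * Translations, dilations and products of functions of one coordinate *)

Section change_of_variables.
Context {R : realType}.
Local Open Scope ereal_scope.
Local Notation leb := (@lebesgue_measure R).
Implicit Types m n : nat.

(** The image of Lebesgue measure under a translation gives half-open intervals their length, and
    this determines the measure. Dilations are treated in the same way below. *)
Lemma ge0_integral_shift (f : R -> \bar R) (a : R) :
  measurable_fun [set: R] f -> (forall x, 0 <= f x) ->
  \int[leb]_x f (x + a)%R = \int[leb]_x f x.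
Proof.
move=> mf f0.
have ms : measurable_fun [set: measurableTypeR R]
    ((fun x => x + a)%R : measurableTypeR R -> measurableTypeR R).
  exact: measurable_funD.
pose nu : {measure set (measurableTypeR R) -> \bar R} :=
  measure_function_pushforward__canonical__measure_function_Measure leb ms.
transitivity (\int[nu]_x f x).
  by rewrite ge0_integral_pushforward.
apply: eq_measure_integral => A mA _.
apply/esym/lebesgue_measure_unique => //= _ [[b c]] _ <-.
rewrite /pushforward.
rewrite (_ : _ @^-1` _ = `](b - a)%R, (c - a)%R]%classic); last first.
  by apply/seteqP; split=> x /=; rewrite !in_itv/= ltrBlDr lerBrDr.
rewrite [RHS]lebesgue_measure_itv [LHS]lebesgue_measure_itv/= !lte_fin ltrD2r.
by case: ifP => _ //; rewrite -!EFinB; congr EFin; ring.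
Qed.

Lemma ge0_integral_scale (f : R -> \bar R) (c : R) : (0 < c)%R ->
  measurable_fun [set: R] f -> (forall x, 0 <= f x) ->
  \int[leb]_x f x = c%:E * \int[leb]_x f (c * x)%R.
Proof.
move=> c0 mf f0.
have ms : measurable_fun [set: measurableTypeR R]
    ((fun x => c * x)%R : measurableTypeR R -> measurableTypeR R).
  exact: measurable_funM.
pose nu : {measure set (measurableTypeR R) -> \bar R} :=
  measure_function_pushforward__canonical__measure_function_Measure leb ms.
have c0' := ltW c0.
transitivity (\int[mscale (NngNum c0') nu]_x f x); last first.
  by rewrite ge0_integral_mscale//= ge0_integral_pushforward.
apply: eq_measure_integral => A mA _.
apply: lebesgue_measure_unique => //= _ [[x y]] _ <-.
rewrite /mscale/= /pushforward.
rewrite (_ : _ @^-1` _ = `](c^-1 * x)%R, (c^-1 * y)%R]%classic); last first.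
  by apply/seteqP; split=> z /=; rewrite !in_itv/= ltr_pdivrMl// ler_pdivlMl.
rewrite [LHS]lebesgue_measure_itv [X in _ * X]lebesgue_measure_itv/=.
rewrite !lte_fin ltr_pM2l ?invr_gt0//; case: ifPn => _; last by rewrite mule0.
by rewrite -!EFinB -EFinM -mulrBr mulrA divff ?gt_eqF// mul1r.
Qed.

Definition addRn n (x : n.-tuple R) (g : 'I_n -> R) : n.-tuple R :=
  [tuple (tnth x j + g j)%R | j < n].

Lemma tnth_addRn n (x : n.-tuple R) g j : tnth (addRn x g) j = (tnth x j + g j)%R.
Proof. exact: tnth_mktuple. Qed.

Lemma measurable_addRn n d (T : measurableType d) (f : T -> n.-tuple R)
    (g : T -> 'I_n -> R) :
  measurable_fun [set: T] f -> (forall j, measurable_fun [set: T] (g ^~ j)) ->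
  measurable_fun [set: T] (fun z => addRn (f z) (g z)).
Proof.
move=> mf mg; apply/measurable_fun_tnthP => i.
rewrite [X in measurable_fun _ X](_ : _ =
    (fun x => tnth (f x) i + g x i)%R); last first.
  by apply/funext => x /=; rewrite tnth_mktuple.
apply: measurable_funD => //.
exact: (measurableT_comp (@measurable_tnth _ R n i)).
Qed.

Lemma measurable_cons_section m (a : R) :
  measurable_fun [set: m.-tuple R] (fun t => [tuple of a :: t]).
Proof. exact: (measurable_fun_pair2 a (@measurable_consT R m)). Qed.

Lemma ge0_integral_addRn n (f : n.-tuple R -> \bar R) (g : 'I_n -> R) :
  measurable_fun [set: n.-tuple R] f -> (forall x, 0 <= f x) ->
  \int[lebn n]_x f (addRn x g) = \int[lebn n]_x f x.
Proof.
elim: n f g => [|n IH] f g mf f0.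
  apply: eq_integral => x _; congr f; apply: eq_from_tnth.
  by case.
have mfa : measurable_fun [set: n.+1.-tuple R] (fun x => f (addRn x g)).
  apply: measurableT_comp => //.
  by apply: measurable_addRn => // j; exact: measurable_cst.
rewrite /= ge0_integral_lebS// ge0_integral_lebS//.
pose F (a : R) := \int[lebn n]_t f [tuple of a :: t].
have mf' : measurable_fun setT (f \o @consT R n).
  by apply: measurableT_comp => //; exact: measurable_consT.
have mF : measurable_fun [set: R] F.
  by apply: (measurable_fun_fubini_tonelli_F (f \o @consT R n)) => // z; apply: f0.
rewrite -(ge0_integral_shift (g ord0) mF); last first.
  by move=> a; exact: integral_ge0.
apply: eq_integral => a _.
rewrite /F -[RHS](IH _ (g \o lift ord0))//; last first.
  have m1 := @measurable_cons_section n (a + g ord0)%R.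
  exact: (measurableT_comp mf m1).
apply: eq_integral => t _; congr f; apply: eq_from_tnth => j.
rewrite tnth_mktuple; case: (unliftP ord0 j) => [k ->|->].
  by rewrite !tnthS tnth_mktuple.
by rewrite !tnth0.
Qed.

Lemma ge0_integral_prod n (F : 'I_n -> R -> \bar R) :
  (forall j, measurable_fun [set: R] (F j)) -> (forall j x, 0 <= F j x) ->
  \int[lebn n]_x \prod_(j < n) F j (tnth x j) =
  \prod_(j < n) \int[leb]_x F j x.
Proof.
elim: n F => [|n IH] F mF F0.
  by under eq_integral do rewrite big_ord0; rewrite integral_dirac//= diracT mul1e big_ord0.
have mprod k (G : 'I_k -> R -> \bar R) :
    (forall j, measurable_fun [set: R] (G j)) ->
    measurable_fun [set: k.-tuple R] (fun x => \prod_(j < k) G j (tnth x j)).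
  elim: k G => [|k IHk] G mG.
    by under eq_fun do rewrite big_ord0; exact: measurable_cst.
  under eq_fun do rewrite big_ord_recl.
  apply: emeasurable_funM.
    exact: (measurableT_comp (mG ord0) (@measurable_tnth _ R _ _)).
  have m1 := IHk (fun j => G (lift ord0 j)) (fun j => mG _).
  have m2 : measurable_fun [set: k.+1.-tuple R] (fun x => (unconsT x).2).
    exact: (measurableT_comp measurable_snd (@measurable_unconsT R k)).
  apply: eq_measurable_fun (measurableT_comp m1 m2) => x _ /=.
  by apply: eq_bigr => j _; rewrite -[x in RHS]unconsTK tnthS.
have prod0 k (G : 'I_k -> R -> \bar R) : (forall j x, 0 <= G j x) ->
    forall x : k.-tuple R, 0 <= \prod_(j < k) G j (tnth x j).
  by move=> G0 x; apply: prode_ge0.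
rewrite /= ge0_integral_lebS//; [|exact: mprod|exact: prod0].
rewrite big_ord_recl -(IH (F \o lift ord0))//; last 2 first.
  by move=> j; exact: mF.
  by move=> j; exact: F0.
rewrite -ge0_integralZr//; last 2 first.
- exact: mF.
- by apply: integral_ge0 => x _; apply: prode_ge0 => j _; exact: F0.
apply: eq_integral => a _.
rewrite -ge0_integralZl//.
- apply: eq_integral => t _; rewrite big_ord_recl tnth0; congr (_ * _).
  by apply: eq_bigr => j _ ; rewrite tnthS.
- by apply: mprod => j; exact: mF.
- by move=> x _; apply: prode_ge0 => j _; exact: F0.
Qed.

End change_of_variables.

(** * Dyadic averages of the finite differences *)

Section dyadic.
Context {R : realType}.
Local Open Scope ereal_scope.
Local Notation leb := (@lebesgue_measure R).

(** From 1 + x <= exp x and ln 2 <= 1. It is what turns 1 - 2^(-(1-s)p) into (1-s)p. *)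
Lemma powR2V_ge (t : R) : (0 <= t -> 1 - t <= (2 `^ t)^-1)%R.
Proof.
move=> t0; rewrite -powRN /powR pnatr_eq0/=.
apply: le_trans (expR_ge1Dx _); rewrite lerD2l mulNr lerN2.
rewrite ler_piMr//; have := @le_ln1Dx R 1.
by rewrite (_ : 1 + 1 = 2)%R//; apply; lra.
Qed.

(* With [I l] the integral of [h^(-1-sp) G h] over [0 < h <= l], scaling by 2 gives
   [I (l/2) >= 2^(sp - p) I l], so the part of [I l] above [l/2] is at most
   [(1 - 2^(-(1-s)p)) I l <= (1-s) p I l]: the factor [1 - s] cancels. *)
Lemma dyadic_bound (G : R -> \bar R) (s p l M : R) :
  measurable_fun [set: R] G -> (forall h, 0 <= G h) ->
  (forall h, G (2 * h)%R <= (2 `^ p)%:E * G h) ->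
  (0 < s < 1)%R -> (0 < p)%R -> (0 < l)%R ->
  (s * (1 - s))%:E * \int[leb]_h (((`|h| `^ (1 + s * p))^-1)%:E * G h) <= M%:E ->
  \int[leb]_h ((\1_(`]l / 2, l]%classic) h)%:E * G h) <=
    (p * M / s * l `^ (1 + s * p))%:E.
Proof.
move=> mG G0 G2 /andP[s0 s1] p0 l0 HM.
pose W := fun h : R => ((`|h| `^ (1 + s * p))^-1)%R.
have W0 h : (0 <= W h)%R by rewrite invr_ge0 powR_ge0.
have mW : measurable_fun [set: R] W.
  rewrite (_ : W = fun h => `|h| `^ (- (1 + s * p)))%R; last first.
    by apply/funext => h; rewrite powRN.
  exact: (measurableT_comp (measurable_powR _) (@normr_measurable R setT)).
pose f (A : set R) h : \bar R := ((\1_A h * W h)%R)%:E * G h.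
have f0 A h : 0 <= f A h by rewrite mule_ge0// lee_fin mulr_ge0.
have mf A : measurable A -> measurable_fun [set: R] (f A).
  move=> mA; apply: emeasurable_funM => //; apply/measurable_EFinP.
  by apply: measurable_funM => //; exact: measurable_indic.
pose F A := \int[leb]_h f A h.
pose I := F `]0%R, l]%classic; pose a := F `]0%R, (l / 2)%R]%classic.
pose D := F `](l / 2)%R, l]%classic.
have F0 A : 0 <= F A by apply: integral_ge0 => h _; exact: f0.
have IE : I = a + D.
  rewrite /I /a /D /F -ge0_integralD//; [|exact: mf|exact: mf].
  apply: eq_integral => h _; rewrite /f -ge0_muleDl ?lee_fin ?mulr_ge0//.
  rewrite -EFinD -mulrDl; congr ((_ * _)%:E * _).
  rewrite !indicE !mem_setE !in_itv/=.
  rewrite [(_ / _ < _)%R]ltNge; case: (ltP 0%R h) => h1; case: (leP h l) => h2;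
    case: (leP h (l / 2)%R) => h3 //=; rewrite ?addr0 ?add0r//; lra.
have ss0 : (0 < s * (1 - s))%R by rewrite mulr_gt0// subr_gt0.
have IM : (s * (1 - s))%:E * I <= M%:E.
  apply: le_trans HM; apply: lee_wpmul2l; first by rewrite lee_fin ltW.
  apply: ge0_le_integral => //.
  - exact: mf.
  - by apply: emeasurable_funM => //; exact/measurable_EFinP.
  - move=> h _; apply: lee_wpmul2r => //; rewrite lee_fin.
    by rewrite -[leRHS]mul1r ler_wpM2r// indicE lern1 leq_b1.
(* Substitute 2h for h: the Jacobian gives 2, the weight 2^(-(1+sp)) and the doubling hypothesis
   2^p, with product 2^((1-s)p). *)
have scal : I <= (2 `^ ((1 - s) * p))%:E * a.
  rewrite /I /F (@ge0_integral_scale R (f _) 2 (ltr0Sn R 1) (mf _ _) (f0 _)); last by [].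
  rewrite (_ : 2 `^ ((1 - s) * p) = 2 * (2 `^ (- (1 + s * p)) * 2 `^ p))%R; last first.
    rewrite -[in LHS](_ : 1 + (- (1 + s * p) + p) = (1 - s) * p)%R; last by ring.
    by rewrite !powRD ?pnatr_eq0 ?implybT// powRr1.
  rewrite EFinM -muleA; apply: lee_wpmul2l => //.
  rewrite -ge0_integralZl//; [|exact: mf].
  apply: ge0_le_integral => //.
  - apply: (measurableT_comp (mf _ _)) => //; exact: measurable_funM.
  - by apply: emeasurable_funM => //; exact: mf.
  move=> h _; rewrite /f.
  have -> : (\1_(`]0%R, l]) (2 * h) * W (2 * h) =
      2 `^ (- (1 + s * p)) * (\1_(`]0%R, (l / 2)%R]) h * W h) :> R)%R.
    rewrite !indicE !mem_setE !in_itv/= pmulr_rgt0// ler_pdivlMr// (mulrC h).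
    by rewrite /W normrM powRM// invfM (ger0_norm (ler0n _ _)) powRN mulrCA.
  rewrite ![(2 `^ (- _) * _)%:E]EFinM -!muleA.
  apply: lee_wpmul2l; first by rewrite lee_fin powR_ge0.
  rewrite muleCA; apply: lee_wpmul2l; first by rewrite lee_fin mulr_ge0.
  exact: G2.
have Ifin : I \is a fin_num.
  rewrite ge0_fin_numE; last exact: F0.
  by rewrite ltey; apply/eqP => Ioo; move: IM; rewrite Ioo gt0_muley ?lte_fin// leye_eq.
have [afin Dfin] : a \is a fin_num /\ D \is a fin_num.
  by move: Ifin; rewrite IE fin_numD => /andP[].
have DM : (fine D <= p * M / s)%R.
  move: scal IM IE; rewrite -(fineK Ifin) -(fineK afin) -(fineK Dfin).
  rewrite -!EFinM -EFinD !lee_fin => scal IM [IE].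
  have c0 : (0 < 2 `^ ((1 - s) * p) :> R)%R by rewrite powR_gt0.
  have : ((1 - (1 - s) * p) * fine I <= fine a)%R.
    apply: (@le_trans _ _ ((2 `^ ((1 - s) * p))^-1 * fine I)%R).
      apply: ler_wpM2r; first by apply/fine_ge0/F0.
      by apply: powR2V_ge; apply: mulr_ge0; [rewrite subr_ge0|]; exact: ltW.
    by rewrite ler_pdivrMl.
  rewrite IE => h1; rewrite [leLHS]/= ler_pdivlMr//.
  have h2 : (fine D <= (1 - s) * p * (fine a + fine D))%R.
    rewrite -subr_ge0 [leRHS](_ : _ = fine a -
      (1 - (1 - s) * p) * (fine a + fine D))%R ?subr_ge0//; ring.
  apply: (@le_trans _ _ ((1 - s) * p * (fine a + fine D) * s)%R).
    by rewrite ler_wpM2r// ltW.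
  rewrite [leLHS](_ : _ = p * (s * (1 - s) * (fine a + fine D)))%R; last by ring.
  by apply: ler_wpM2l; [exact: ltW|rewrite -IE].
(* On []l / 2, l]] the weight [W] is at least l^(-(1+sp)), so it can be removed at the cost of
   l^(1+sp). *)
apply: (@le_trans _ _ ((l `^ (1 + s * p))%:E * D)).
  rewrite -ge0_integralZl//; [|exact: mf|by rewrite lee_fin powR_ge0].
  apply: ge0_le_integral => //.
  - by move=> h _; rewrite mule_ge0// lee_fin.
  - apply: emeasurable_funM => //; apply/measurable_EFinP.
    exact: measurable_indic.
  - by apply: emeasurable_funM => //; exact: mf.
  move=> h _; rewrite /f muleA -EFinM; apply: lee_wpmul2r => //.
  rewrite lee_fin !indicE !mem_setE !in_itv/=; case: (boolP (_ && _)) => [/andP[h1 h2]|_]; last first.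
    by rewrite mul0r mulr0.
  rewrite mul1r ler_pdivlMr ?mul1r; last first.
    by rewrite powR_gt0// normr_gt0 gt_eqF//; apply: le_lt_trans h1; rewrite divr_ge0// ltW.
  have h0 : (0 < h)%R by apply: le_lt_trans h1; rewrite divr_ge0// ltW.
  rewrite gtr0_norm//; apply: ge0_ler_powR => //; rewrite ?nnegrE ?ltW//.
  by rewrite addr_gt0// mulr_gt0.
rewrite -(fineK Dfin) -EFinM lee_fin mulrC.
by rewrite ler_wpM2r// powR_ge0.
Qed.

End dyadic.

(** * Differences along a coordinate axis *)

Section differences.
Context {R : realType}.
Local Open Scope ereal_scope.
Local Notation leb := (@lebesgue_measure R).

(** Convexity of t^p at the midpoint of |a| and |b|. The constant 2^(p-1) matters: it makes the
    doubling constant of [diffp] exactly 2^p, and any larger one would leave a factor that does not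
    tend to 1 as s tends to 1. *)
Lemma powR_normD_le (a b p : R) : (1 <= p)%R ->
  (`|a + b| `^ p <= 2 `^ (p - 1) * (`|a| `^ p + `|b| `^ p))%R.
Proof.
move=> p1; have p0 : (0 <= p)%R by apply: le_trans p1.
have h0 : (0 <= 2^-1 :> R)%R by rewrite invr_ge0.
have h1 : (2^-1 <= 1 :> R)%R by rewrite invf_le1 ?ler1n.
have : ((2^-1 * `|a| + (1 - 2^-1) * `|b|) `^ p <=
    2^-1 * `|a| `^ p + (1 - 2^-1) * `|b| `^ p)%R.
  by apply: (convex_powR p1 (Itv01 h0 h1)); rewrite !inE/= in_itv/= normr_ge0.
rewrite (_ : 1 - 2^-1 = 2^-1 :> R)%R; last by field.
rewrite -!mulrDr powRM ?invr_ge0 ?addr_ge0// => h.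
apply: (@le_trans _ _ ((`|a| + `|b|) `^ p)%R).
  by apply: ge0_ler_powR => //; rewrite ?nnegrE ?addr_ge0// ler_normD.
move: h; rewrite -(@powR_inv1 R 2)// -powRrM mulN1r.
rewrite powRN mulrC ler_pdivrMr ?powR_gt0// => h; apply: le_trans h _.
rewrite powRN powRr1// mulrAC (mulrC (2^-1)%R).
by rewrite powRB ?pnatr_eq0 ?implybT// powRr1.
Qed.

Lemma measurable_powR_norm d (T : measurableType d) (f : T -> R) (p : R) :
  measurable_fun [set: T] f -> measurable_fun [set: T] (fun x => (`|f x| `^ p)%:E).
Proof.
move=> mf; apply/measurable_EFinP.
apply: (measurableT_comp (measurable_powR p)).
exact: (measurableT_comp (@normr_measurable R setT)).
Qed.

Section directional.
Context {n : nat}.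
Variables (u : n.-tuple R -> R) (mu : measurable_fun [set: n.-tuple R] u).

Definition diffp (i : 'I_n) (p h : R) : \bar R :=
  \int[lebn n]_x (`|u (shiftRn x i h) - u x| `^ p)%:E.

Lemma measurable_shift_fun d (T : measurableType d) (f : T -> n.-tuple R)
    (g : T -> R) i :
  measurable_fun [set: T] f -> measurable_fun [set: T] g ->
  measurable_fun [set: T] (fun z => u (shiftRn (f z) i (g z)) - u (f z))%R.
Proof.
move=> mf mg; apply: measurable_funB; last exact: (measurableT_comp mu mf).
have m1 : measurable_fun [set: T] (fun z => shiftRn (f z) i (g z)).
  apply: (measurable_addRn (g := fun z j => if j == i then g z else 0%R)) => //.
  by move=> j /=; case: (j == i) => //; exact: measurable_cst.
exact: (measurableT_comp mu m1).
Qed.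

Lemma measurable_diffp_joint i p : measurable_fun
  [set: (measurableTypeR R * n.-tuple R)%type]
  (fun z => (`|u (shiftRn z.2 i z.1) - u z.2| `^ p)%:E).
Proof.
apply: measurable_powR_norm.
apply: (measurable_shift_fun (f := snd) (g := fst)).
- exact: measurable_snd.
- exact: measurable_fst.
Qed.

Lemma diffp_ge0 i p h : 0 <= diffp i p h.
Proof. by apply: integral_ge0 => x _; rewrite lee_fin powR_ge0. Qed.

Lemma measurable_diffp i p : measurable_fun [set: R] (diffp i p).
Proof.
apply: (measurable_fun_fubini_tonelli_F (m2 := lebn n)
  (fun z : measurableTypeR R * n.-tuple R =>
    (`|u (shiftRn z.2 i z.1) - u z.2| `^ p)%:E)).
- exact: measurable_diffp_joint.
- by move=> z; rewrite lee_fin powR_ge0.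
Qed.

Lemma measurable_shift i h p : measurable_fun [set: n.-tuple R]
  (fun x => (`|u (shiftRn x i h) - u x| `^ p)%:E).
Proof. exact: (measurable_fun_pair2 h (measurable_diffp_joint i p)). Qed.

(** The difference over 2h is the sum of two consecutive differences over h, whose integrals agree
    by translation invariance. *)
Lemma diffp_double i p h : (1 <= p)%R ->
  diffp i p (2 * h)%R <= (2 `^ p)%:E * diffp i p h.
Proof.
move=> p1.
pose g x := (`|u (shiftRn x i h) - u x| `^ p)%:E.
have g0 x : 0 <= g x by rewrite lee_fin powR_ge0.
have mg : measurable_fun [set: n.-tuple R] g by exact: measurable_shift.
pose e := fun j : 'I_n => if j == i then h else 0%R.
have mge : measurable_fun [set: n.-tuple R] (fun x => g (addRn x e)).
  have m1 : measurable_fun [set: n.-tuple R] (fun x => addRn x e).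
    by apply: measurable_addRn => // j; exact: measurable_cst.
  exact: (measurableT_comp mg m1).
have Dg : diffp i p h = \int[lebn n]_x g (addRn x e).
  by rewrite ge0_integral_addRn.
have -> : (2 `^ p)%:E * diffp i p h =
    \int[lebn n]_x ((2 `^ (p - 1))%:E * (g (addRn x e) + g x)).
  rewrite ge0_integralTZl ?powR_ge0//; last 2 first.
  - exact: emeasurable_funD.
  - by move=> x; rewrite adde_ge0.
  rewrite ge0_integralTD// -Dg -/(diffp i p h).
  rewrite (_ : 2 `^ p = 2 `^ (p - 1) * 2)%R; last first.
    by rewrite -[in LHS](subrK 1%R p) powRD ?pnatr_eq0 ?implybT// powRr1.
  by rewrite EFinM -muleA; congr (_ * _); rewrite mule_natl mule2n.
apply: ge0_le_integralT.
- exact: measurable_shift.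
- apply: emeasurable_funM; first exact: measurable_cst.
  exact: emeasurable_funD.
- by move=> x; rewrite lee_fin powR_ge0.
move=> x; rewrite /g -EFinD -EFinM lee_fin.
have -> : (u (shiftRn x i (2 * h)) - u x =
   (u (shiftRn (addRn x e) i h) - u (addRn x e)) + (u (shiftRn x i h) - u x))%R.
  rewrite (_ : shiftRn (addRn x e) i h = shiftRn x i (2 * h)); last first.
    apply: eq_from_tnth => j; rewrite !tnth_mktuple /e.
    by case: ifP => _; ring.
  rewrite -[shiftRn x i h]/(addRn x e); ring.
exact: powR_normD_le.
Qed.

(** Tonelli moves the integral in h outside, the form in which [dyadic_bound] applies with [diffp]
    as its function of h. *)
Lemma Jfrac_iE i s p : Jfrac_i i s p u =
  (s * (1 - s))%:E *
  \int[leb]_h (((`|h| `^ (1 + s * p))^-1)%:E * diffp i p h).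
Proof.
rewrite /Jfrac_i; congr (_ * _).
pose f (z : measurableTypeR R * n.-tuple R) : \bar R :=
  ((`|z.1| `^ (1 + s * p))^-1)%:E * (`|u (shiftRn z.2 i z.1) - u z.2| `^ p)%:E.
have f0 z : 0 <= f z by rewrite mule_ge0// lee_fin ?invr_ge0 powR_ge0.
have mf : measurable_fun setT f.
  apply: emeasurable_funM; last exact: measurable_diffp_joint.
  rewrite (_ : (fun x => _) =
    (fun x : measurableTypeR R * n.-tuple R => (`|x.1| `^ (- (1 + s * p)))%:E)).
    apply: measurable_powR_norm; exact: measurable_fst.
  by apply/funext => x; rewrite powRN.
have E x : \int[leb]_h
     (`|u (shiftRn x i h) - u x| `^ p / `|h| `^ (1 + s * p))%:E =
   \int[leb]_h f (h, x).
  by apply: eq_integral => h _; rewrite /f/= -EFinM mulrC.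
rewrite intRnE; last 2 first.
- under eq_fun do rewrite E.
  exact: (measurable_fun_fubini_tonelli_G (m1 := leb) f).
- by move=> x; rewrite E; exact: integral_ge0.
under eq_integral do rewrite E.
rewrite -(fubini_tonelli (m1 := leb) (m2 := lebn n) f)//.
apply: eq_integral => h _; rewrite /f/= ge0_integralZl//.
exact: measurable_shift.
Qed.

Lemma diffp_dyadic i s p l M : (0 < s < 1)%R -> (1 <= p)%R -> (0 < l)%R ->
  Jfrac_i i s p u <= M%:E ->
  \int[leb]_h ((\1_(`]l / 2, l]%classic) h)%:E * diffp i p h) <=
    (p * M / s * l `^ (1 + s * p))%:E.
Proof.
move=> s01 p1 l0; rewrite Jfrac_iE => HM.
apply: dyadic_bound => //.
- exact: measurable_diffp.
- by move=> h; exact: diffp_ge0.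
- by move=> h; exact: diffp_double.
- exact: lt_le_trans p1.
Qed.

End directional.
End differences.

(** * Differences averaged over boxes of translations *)

Section boxes.
Context {R : realType}.
Local Open Scope ereal_scope.
Local Notation leb := (@lebesgue_measure R).

Section box.
Context {n : nat}.
Variables (u : n.-tuple R -> R) (mu : measurable_fun [set: n.-tuple R] u).
Implicit Types (l : 'I_n -> R) (x : n.-tuple R).

(** Each side is a dyadic layer, since [diffp_dyadic] bounds the differences only on such layers.
    Hence the lengths [l j / 2] in [vol]. *)
Definition box l : set (n.-tuple R) :=
  [set h | forall j, l j / 2 < tnth h j <= l j]%R.

Definition vol l : R := (\prod_(j < n) (l j / 2))%R.

Lemma vol_gt0 l : (forall j, 0 < l j)%R -> (0 < vol l)%R.
Proof. by move=> l0; apply: prodr_gt0 => j _; rewrite divr_gt0. Qed.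

Lemma indic_boxE l h :
  (\1_(box l) h : R) = (\prod_(j < n) \1_(`](l j / 2)%R, l j]%classic) (tnth h j))%R.
Proof.
rewrite indicE; have [hl|hl] := pselect (box l h).
  rewrite mem_set// big1// => j _.
  by rewrite indicE mem_set//= in_itv/=; exact: hl.
rewrite memNset//; have [j hj] : exists j, ~~ (l j / 2 < tnth h j <= l j)%R.
  apply/existsP; rewrite -negb_forall; apply/negP => /forallP hj.
  by apply: hl => j; exact: hj.
rewrite (bigD1 j)//= indicE memNset ?mul0r//= in_itv/=.
exact/negP.
Qed.

Lemma measurable_box l : measurable (box l).
Proof.
apply/measurable_indicP; rewrite (_ : \1_(box l) = fun h : n.-tuple R =>
    \prod_(j < n) \1_(`](l j / 2)%R, l j]%classic) (tnth h j))%R; last first.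
  by apply/funext => h; exact: indic_boxE.
apply: measurable_prod => j _.
apply: (measurableT_comp (f := \1_(`](l j / 2)%R, l j]%classic) : R -> R)).
  exact: measurable_indic.
exact: (@measurable_tnth _ R n j).
Qed.

Lemma measurable_indic_box l :
  measurable_fun [set: n.-tuple R] (\1_(box l) : n.-tuple R -> R).
Proof. by apply: measurable_indic; exact: measurable_box. Qed.

(** The other coordinates contribute their lengths, which leaves the volume divided by [l i / 2]. *)
Lemma integral_box_coord l i (G : R -> \bar R) :
  measurable_fun [set: R] G -> (forall h, 0 <= G h) -> (forall j, 0 < l j)%R ->
  \int[lebn n]_h ((\1_(box l) h)%:E * G (tnth h i)) =
  (vol l * (2 / l i))%:E *
    \int[leb]_h ((\1_(`](l i / 2)%R, l i]%classic) h)%:E * G h).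
Proof.
move=> mG G0 l0.
pose F j h := (\1_(`](l j / 2)%R, l j]%classic) h)%:E *
   (if j == i then G h else 1).
have F0 j h : 0 <= F j h by rewrite mule_ge0 ?lee_fin//; case: ifP.
have mF j : measurable_fun [set: R] (F j).
  apply: emeasurable_funM; first by apply/measurable_EFinP; exact: measurable_indic.
  by case: (j == i) => //; exact: measurable_cst.
transitivity (\int[lebn n]_h \prod_(j < n) F j (tnth h j)).
  apply: eq_integral => h _; rewrite /F big_split/= prodEFin -indic_boxE.
  congr (_ * _); rewrite (bigD1 i)//= eqxx big1 ?mule1// => j /negbTE ->//.
rewrite ge0_integral_prod// (bigD1 i)//= /F eqxx muleC; congr (_ * _).
rewrite (eq_bigr (fun j => (l j / 2)%:E)); last first.
  move=> j ji; under eq_integral do rewrite (negbTE ji) mule1.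
  rewrite integral_indic//= setIT [LHS]lebesgue_measure_itv/= lte_fin.
  by rewrite ltr_pdivrMr// ltr_pMr// ltr1n -EFinB; congr EFin; field.
rewrite prodEFin /vol [in RHS](bigD1 i)//=; congr EFin.
rewrite [RHS]mulrC mulrA (_ : 2 / l i * (l i / 2) = 1)%R ?mul1r//.
by field; rewrite gt_eqF.
Qed.

Lemma integral_box l : (forall j, 0 < l j)%R ->
  \int[lebn n]_h (\1_(box l) h)%:E = (vol l)%:E.
Proof.
move=> l0.
transitivity (\int[lebn n]_h \prod_(j < n)
    (\1_(`](l j / 2)%R, l j]%classic) (tnth h j))%:E).
  by apply: eq_integral => h _; rewrite prodEFin -indic_boxE.
rewrite (ge0_integral_prod (F := fun j h => (\1_(`](l j / 2)%R, l j]%classic) h)%:E))//.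
  rewrite -prodEFin; apply: eq_bigr => j _.
  rewrite integral_indic//= setIT [LHS]lebesgue_measure_itv/= lte_fin.
  by rewrite ltr_pdivrMr// ltr_pMr// ltr1n -EFinB; congr EFin; field.
by move=> j; apply/measurable_EFinP; exact: measurable_indic.
Qed.

(** The points [addRn x (trunc h k)], for k from 0 to n, are the vertices of a path from x to x + h
    that moves along one axis at a time; [step i] is the increment of u on its edge number i. *)
Definition trunc (h : n.-tuple R) (k : nat) : 'I_n -> R := fun j => if (j < k)%N then tnth h j else 0%R.

Definition step (i : 'I_n) x (h : n.-tuple R) : R :=
  (u (addRn x (trunc h i.+1)) - u (addRn x (trunc h i)))%R.

Lemma step_telescope x h :
  (`|u (addRn x (tnth h)) - u x| <= \sum_(i < n) `|step i x h|)%R.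
Proof.
apply: le_trans (ler_norm_sum _ _ _); rewrite /step.
rewrite -(big_mkord xpredT (fun i => u (addRn x (trunc h i.+1)) - u (addRn x (trunc h i))))%R.
rewrite telescope_sumr// le_eqVlt; apply/orP; left; apply/eqP.
congr (`|u _ - u _|)%R; apply: eq_from_tnth => j; rewrite !tnth_mktuple /trunc.
  by rewrite ltn_ord.
by rewrite ltn0 addr0.
Qed.

Lemma step_shift i x h : step i x h =
  (u (shiftRn (addRn x (trunc h i)) i (tnth h i)) - u (addRn x (trunc h i)))%R.
Proof.
rewrite /step; congr (u _ - _)%R.
apply: eq_from_tnth => j; rewrite !tnth_mktuple /trunc -addrA; congr (_ + _)%R.
rewrite ltnS leq_eqVlt; have [->|ji] := eqVneq j i.
  by rewrite eqxx/= ltnn add0r.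
by rewrite (_ : (j == i :> nat) = false)/= ?addr0//; exact/negbTE.
Qed.

Lemma measurable_addRn_trunc k : measurable_fun
  [set: (n.-tuple R * n.-tuple R)%type] (fun z => addRn z.2 (trunc z.1 k)).
Proof.
apply: measurable_addRn; first exact: measurable_snd.
move=> j; rewrite /trunc; case: (j < k)%N; last exact: measurable_cst.
exact: (measurableT_comp (@measurable_tnth _ R n j) measurable_fst).
Qed.

Lemma measurable_step i : measurable_fun
  [set: (n.-tuple R * n.-tuple R)%type] (fun z => step i z.2 z.1).
Proof.
by apply: measurable_funB;
  exact: (measurableT_comp mu (measurable_addRn_trunc _)).
Qed.

Lemma integral_step i p h :
  \int[lebn n]_x (`|step i x h| `^ p)%:E = diffp u i p (tnth h i).
Proof.
under eq_integral do rewrite step_shift.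
rewrite (ge0_integral_addRn (f := fun x =>
  (`|u (shiftRn x i (tnth h i)) - u x| `^ p)%:E))//.
exact: measurable_shift.
Qed.

(** After integration in x, the i-th step depends on h only through its i-th coordinate, by
    translation invariance, so each direction becomes a one-dimensional integral. One factor [l i]
    of the hypothesis cancels against the division by [l i / 2]. The weights [c] are free because
    they are chosen differently for the weak type bound and for the approximation in L^1. *)
Lemma box_estimate (l p sig c : 'I_n -> R) (C : R) :
  (forall j, 0 < l j)%R -> (forall j, 0 <= c j)%R ->
  (forall i, \int[leb]_h ((\1_(`](l i / 2)%R, l i]%classic) h)%:E *
      diffp u i (p i) h) <= (C * l i `^ (1 + sig i * p i))%:E) ->
  \int[lebn n]_h ((\1_(box l) h)%:E *
     \int[lebn n]_x (\sum_(i < n) c i * `|step i x h| `^ p i)%:E) <=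
  (vol l * \sum_(i < n) c i * (2 * C * l i `^ (sig i * p i)))%:E.
Proof.
move=> l0 c0 HC.
have E h : \int[lebn n]_x (\sum_(i < n) c i * `|step i x h| `^ p i)%:E =
    \sum_(i < n) (c i)%:E * diffp u i (p i) (tnth h i).
  under eq_integral do rewrite -sumEFin.
  have m i : measurable_fun [set: n.-tuple R]
      (fun x => (`|step i x h| `^ p i)%:E).
    apply: measurable_powR_norm.
    exact: (measurable_fun_pair2 h (measurable_step i)).
  rewrite ge0_integral_sum//; last 2 first.
  - move=> i; under eq_fun do rewrite EFinM.
    by apply: emeasurable_funM => //; exact: measurable_cst.
  - by move=> i x _; rewrite lee_fin mulr_ge0// powR_ge0.
  apply: eq_bigr => i _; under eq_integral do rewrite EFinM.
  by rewrite (ge0_integralTZl _ (m i) _ (c0 i)) ?integral_step// => x; rewrite lee_fin powR_ge0.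
under eq_integral => h _.
  rewrite E ge0_sume_distrr; last first.
    by move=> i _; rewrite mule_ge0 ?lee_fin ?diffp_ge0.
  over.
have mb : measurable_fun [set: n.-tuple R] (fun h => (\1_(box l) h : R)%:E).
  by apply/measurable_EFinP; apply: measurable_indic; exact: measurable_box.
have md i : measurable_fun [set: n.-tuple R]
    (fun h => diffp u i (p i) (tnth h i)).
  exact: (measurableT_comp (measurable_diffp mu i (p i)) (@measurable_tnth _ R n i)).
rewrite ge0_integral_sum//; last 2 first.
- move=> i; apply: emeasurable_funM => //.
  by apply: emeasurable_funM => //; exact: measurable_cst.
- by move=> i h _; rewrite !mule_ge0 ?lee_fin ?diffp_ge0.
rewrite mulr_sumr -sumEFin; apply: lee_sum => i _.
under eq_integral do rewrite muleCA.
rewrite ge0_integralTZl; last 3 first.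
- exact: emeasurable_funM.
- by move=> h; rewrite mule_ge0 ?lee_fin ?diffp_ge0.
- exact: c0.
rewrite integral_box_coord//; last 2 first.
- exact: measurable_diffp.
- by move=> h; exact: diffp_ge0.
rewrite [leRHS](_ : _ = (c i)%:E *
    (vol l * (2 * C * l i `^ (sig i * p i)))%:E); last by rewrite -EFinM mulrCA.
apply: lee_wpmul2l; first by rewrite lee_fin.
apply: (@le_trans _ _ ((vol l * (2 / l i))%:E * (C * l i `^ (1 + sig i * p i))%:E)).
  apply: lee_wpmul2l; last exact: HC.
  by rewrite lee_fin mulr_ge0 ?divr_ge0 ?(ltW (vol_gt0 l0))// ltW.
rewrite -EFinM lee_fin powRD; last by rewrite (gt_eqF (l0 i)) implybT.
rewrite (powRr1 (ltW (l0 i))) le_eqVlt; apply/orP; left; apply/eqP.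
by field; rewrite gt_eqF.
Qed.

End box.
End boxes.

(** * Weak type bound and uniform integrability *)

Section weak_type.
Context {R : realType}.
Local Open Scope ereal_scope.
Local Notation leb := (@lebesgue_measure R).

Section fixed_function.
Context {n : nat}.
Variables (u : n.-tuple R -> R) (mu : measurable_fun [set: n.-tuple R] u).
Variables (p sig : 'I_n -> R) (C : R).

(** All that is kept of the energy bound. It does not mention [s k], so the constants derived from
    it are uniform in k. *)
Definition anisotropic_bound := forall (i : 'I_n) (l : R), (0 < l <= 1)%R ->
  \int[leb]_h ((\1_(`]l / 2, l]%classic) h)%:E * diffp u i (p i) h) <=
    (C * l `^ (1 + sig i * p i))%:E.

Hypothesis Hu : anisotropic_bound.

Definition wstep (c : 'I_n -> R) (x h : n.-tuple R) : R :=
  (\sum_(i < n) c i * `|step u i x h| `^ p i)%R.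

Lemma wstep_ge0 c x h : (forall i, 0 <= c i)%R -> (0 <= wstep c x h)%R.
Proof. by move=> c0; apply: sumr_ge0 => i _; rewrite mulr_ge0// powR_ge0. Qed.

Lemma measurable_wstep c : measurable_fun
  [set: (n.-tuple R * n.-tuple R)%type] (fun z => wstep c z.2 z.1).
Proof.
apply: measurable_sum => i; apply: measurable_funM; first exact: measurable_cst.
by have /measurable_EFinP := measurable_powR_norm (p i) (measurable_step mu i).
Qed.

Lemma box_wstep_estimate (l c : 'I_n -> R) :
  (forall j, 0 < l j <= 1)%R -> (forall j, 0 <= c j)%R ->
  \int[lebn n]_x \int[lebn n]_h (\1_(box l) h * wstep c x h)%:E <=
  (vol l * \sum_(i < n) c i * (2 * C * l i `^ (sig i * p i)))%:E.
Proof.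
move=> l01 c0.
have l0 j : (0 < l j)%R by have /andP[] := l01 j.
pose f (z : n.-tuple R * n.-tuple R) : \bar R :=
  (\1_(box l) z.1 * wstep c z.2 z.1)%:E.
have f0 z : 0 <= f z by rewrite lee_fin mulr_ge0// wstep_ge0.
have mf : measurable_fun setT f.
  apply/measurable_EFinP; apply: measurable_funM; last exact: measurable_wstep.
  apply: (measurableT_comp (f := \1_(box l) : _ -> R)); last exact: measurable_fst.
  exact: measurable_indic_box.
rewrite -(fubini_tonelli (m1 := lebn n) (m2 := lebn n) f)//.
have HB := box_estimate mu l0 c0 (fun i => Hu i (l01 i)).
apply: (le_trans _ HB).
rewrite le_eqVlt; apply/orP; left; apply/eqP; apply: eq_integral => h _.
rewrite -ge0_integralTZl//.
- rewrite (_ : (fun x => (wstep c x h)%:E) = EFin \o (fun x => wstep c x h))//.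
  apply/measurable_EFinP.
  exact: (measurable_fun_pair2 h (measurable_wstep c)).
- by move=> x; rewrite lee_fin wstep_ge0.
Qed.

Lemma addRnC (x h : n.-tuple R) : addRn x (tnth h) = addRn h (tnth x).
Proof. by apply: eq_from_tnth => j; rewrite !tnth_mktuple addrC. Qed.

(** Among n steps whose absolute values add up to more than [la], one is at least [la / n] in
    absolute value; its weight raises its power to at least 1. *)
Lemma wstep_ge1 (la : R) x h : (0 < n)%N -> (0 < la)%R -> (forall i, 0 <= p i)%R ->
  (la < `|u (addRn x (tnth h)) - u x|)%R ->
  (1 <= wstep (fun i => (n%:R / la) `^ p i) x h)%R.
Proof.
move=> n0 la0 p0 H.
have [i Hi] : exists i, (la / n%:R <= `|step u i x h|)%R.
  apply/existsP; rewrite -[X in is_true X]negbK negb_exists.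
  apply/negP => /forallP Hi.
  have := lt_le_trans H (step_telescope u x h); rewrite ltNge => /negP; apply.
  apply: (@le_trans _ _ (\sum_(i < n) la / n%:R)%R).
    by apply: ler_sum => i _; rewrite ltW// ltNge Hi.
  rewrite sumr_const card_ord -[leLHS]mulr_natr divfK//.
  by rewrite pnatr_eq0 -lt0n.
rewrite /wstep (bigD1 i)//=; apply: ler_wpDr.
  by apply: sumr_ge0 => j _; rewrite mulr_ge0// powR_ge0.
have nla : (0 <= n%:R / la)%R by rewrite divr_ge0// ltW.
rewrite -powRM// [leLHS](_ : _ = 1 `^ p i)%R; last by rewrite powR1.
apply: ge0_ler_powR => //; rewrite ?nnegrE//; first by rewrite mulr_ge0.
by rewrite mulrAC ler_pdivlMr// mul1r mulrC -ler_pdivrMr ?ltr0n.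
Qed.

(* The side [l_i = la^(-(q - p_i) / (sig_i p_i))] balances the [n] directions. Where
   [|u x| > 2 la], the smallness of [{|u| > la}] makes [|u (x + h)| <= la] for at least
   half of the [h] in the box, so some step of the path from [x] to [x + h] exceeds
   [la / n]. *)
Lemma weak_type (P q N la : R) : (0 < n)%N -> (0 <= C)%R ->
  (forall i, 0 < p i)%R -> (forall i, 0 < sig i)%R -> (forall i, p i <= q)%R ->
  (0 < P)%R -> (1 <= la)%R ->
  pint P u <= N%:E ->
  (2 * N * la `^ (- P) <=
     2^-1 ^+ n * la `^ (- \sum_(i < n) (q - p i) / (sig i * p i)))%R ->
  lebn n [set x | (2 * la < `|u x|)%R] <=
    (4 * C * (\sum_(i < n) n%:R `^ p i) * la `^ (- q))%:E.
Proof.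
move=> n0 C0 p0 sig0 pq P0 la1 HN Hla.
have la0 : (0 < la)%R by apply: lt_le_trans la1.
pose l i : R := (la `^ (- ((q - p i) / (sig i * p i))))%R.
have sp0 i : (0 < sig i * p i)%R by rewrite mulr_gt0.
have l01 i : (0 < l i <= 1)%R.
  rewrite powR_gt0//= -(powRr0 la); apply: ler_powR => //.
  by rewrite oppr_le0 divr_ge0 ?subr_ge0// ltW.
have l0 j : (0 < l j)%R by have /andP[] := l01 j.
pose c i : R := ((n%:R / la) `^ p i)%R.
have c0 i : (0 <= c i)%R by rewrite powR_ge0.
have volE : vol l = (2^-1 ^+ n *
    la `^ (- \sum_(i < n) (q - p i) / (sig i * p i)))%R.
  rewrite /vol big_split/= prodr_const card_ord mulrC.
  congr (_ * _)%R; rewrite -sumrN /l.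
  elim/big_rec2: _ => [|i y x _ ->]; first by rewrite powRr0.
  by rewrite powRD// (gt_eqF la0) implybT.
have vol0 := vol_gt0 l0.
pose E := [set x | (2 * la < `|u x|)%R].
have mE : measurable E.
  rewrite (_ : E = (fun x => `|u x|)%R @^-1` `]2 * la, +oo[%classic)%R; last first.
    by apply/seteqP; split => x /=; rewrite in_itv/= andbT.
  rewrite -[X in measurable X]setTI.
  by apply: (measurableT_comp (@normr_measurable R setT) mu).
have mw x : measurable_fun [set: n.-tuple R]
    (fun h => (\1_(box l) h * wstep c x h)%:E).
  apply/measurable_EFinP; apply: measurable_funM.
    exact: measurable_indic_box.
  exact: (measurable_fun_pair1 x (measurable_wstep c)).
have w0 x h : (0 <= (\1_(box l) h * wstep c x h)%:E).
  by rewrite lee_fin mulr_ge0// wstep_ge0.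
have key x : ((vol l / 2)%:E * (\1_E x)%:E <=
    \int[lebn n]_h (\1_(box l) h * wstep c x h)%:E).
  rewrite indicE; have [Ex|Ex] := pselect (E x); last first.
    by rewrite memNset// mule0; apply: integral_ge0.
  rewrite mem_set// mule1.
  have mup : measurable_fun [set: n.-tuple R] (fun h => (`|u h| `^ P)%:E).
    exact: measurable_powR_norm.
  have mupx : measurable_fun [set: n.-tuple R]
      (fun h => (`|u (addRn h (tnth x))| `^ P)%:E).
    have m1 : measurable_fun [set: n.-tuple R] (fun h => addRn h (tnth x)).
      by apply: measurable_addRn => // j; exact: measurable_cst.
    exact: (measurableT_comp mup m1).
  (* Instead of splitting the box, the term (|u(x+h)|/la)^P is added to [wstep]: for each h in the
     box one of the two is at least 1. *)
  have H1 : (vol l)%:E <= \int[lebn n]_h ((\1_(box l) h * wstep c x h)%:E +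
       (la `^ (- P))%:E * (`|u (addRn h (tnth x))| `^ P)%:E).
    rewrite -integral_box//; apply: ge0_le_integralT => //.
    - by apply/measurable_EFinP; exact: measurable_indic_box.
    - by apply: emeasurable_funD => //; apply: emeasurable_funM.
    move=> h; rewrite -EFinM -EFinD lee_fin.
    have [hu|hu] := ltP la `|u (addRn h (tnth x))|%R.
      apply: (@le_trans _ _ 1%R); first by rewrite indicE lern1 leq_b1.
      apply: ler_wpDl; first by rewrite mulr_ge0// wstep_ge0.
      rewrite powRN mulrC ler_pdivlMr ?powR_gt0// mul1r.
      by apply: ge0_ler_powR; rewrite ?nnegrE ?(ltW la0) ?(ltW P0)// ltW.
    apply: ler_wpDr; first by rewrite mulr_ge0 ?powR_ge0.
    rewrite -[leLHS]mulr1 ler_wpM2l//; apply: wstep_ge1 => //.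
      by move=> i; exact: ltW.
    rewrite addRnC distrC; apply: lt_le_trans (lerB_dist _ _).
    have := Ex; rewrite /E/=; lra.
  (* Seen as a function of h, u(x+h) is a translate of u, so its integral is bounded by [N]; the
     hypothesis on [la] says exactly that the result is at most half the volume. *)
  have H2 : (la `^ (- P))%:E * \int[lebn n]_h (`|u (addRn h (tnth x))| `^ P)%:E
     <= (vol l / 2)%:E.
    rewrite (ge0_integral_addRn _ mup); last by move=> h; rewrite lee_fin powR_ge0.
    rewrite -intRnE//.
    apply: (@le_trans _ _ ((la `^ (- P))%:E * N%:E)).
      by apply: lee_wpmul2l => //; rewrite lee_fin powR_ge0.
    rewrite -EFinM lee_fin ler_pdivlMr// volE.
    by apply: le_trans Hla; rewrite le_eqVlt; apply/orP; left; apply/eqP; ring.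
  move: H1; rewrite ge0_integralTD//; last 2 first.
  - by apply: emeasurable_funM => //; exact: measurable_cst.
  - by move=> h; rewrite mule_ge0// lee_fin powR_ge0.
  rewrite ge0_integralTZl ?powR_ge0//.
  move=> /le_trans/(_ (leeD2l _ H2)); rewrite -leeBlDr// -EFinB.
  by rewrite (_ : vol l - vol l / 2 = vol l / 2)%R//; field.
have H3 : (vol l / 2)%:E * lebn n E <=
    (vol l * (2 * C * (\sum_(i < n) n%:R `^ p i) * la `^ (- q)))%:E.
  have -> : lebn n E = \int[lebn n]_x (\1_E x)%:E by rewrite integral_indic// setIT.
  rewrite -ge0_integralTZl//; last 2 first.
  - by apply/measurable_EFinP; exact: measurable_indic.
  - by rewrite divr_ge0// ltW.
  apply: (@le_trans _ _ (\int[lebn n]_x \int[lebn n]_h (\1_(box l) h * wstep c x h)%:E)).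
    apply: ge0_le_integralT => //.
    - apply: emeasurable_funM; first exact: measurable_cst.
      by apply/measurable_EFinP; exact: measurable_indic.
    - apply: (measurable_fun_fubini_tonelli_G (m1 := lebn n) (fun z =>
        (\1_(box l) z.1 * wstep c z.2 z.1)%:E)) => //.
        apply/measurable_EFinP; apply: measurable_funM; last exact: measurable_wstep.
        apply: (measurableT_comp (f := \1_(box l) : _ -> R)); last exact: measurable_fst.
        exact: measurable_indic_box.
    - by move=> x; rewrite mule_ge0// lee_fin// divr_ge0// ltW.
  apply: le_trans (box_wstep_estimate l01 c0) _.
  rewrite lee_fin; apply: ler_wpM2l; first exact: ltW.
  rewrite mulr_sumr mulr_suml.
  rewrite le_eqVlt; apply/orP; left; apply/eqP; apply: eq_bigr => i _.
  (* The weight gives la^(-p_i) and the side la^(-(q-p_i)), so every direction contributes the same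
     power la^(-q). *)
  rewrite /c /l powRM ?invr_ge0 ?(ltW la0)// -powRrM mulNr divfK ?gt_eqF//.
  rewrite -(powR_inv1 (ltW la0)) -powRrM mulN1r.
  have -> : (- q = - p i - (q - p i))%R by ring.
  by rewrite powRD ?(gt_eqF la0) ?implybT//; ring.
move: H3; rewrite -lee_pdivlMl ?divr_gt0// -EFinM => /le_trans; apply.
rewrite lee_fin le_eqVlt; apply/orP; left; apply/eqP; field.
by rewrite gt_eqF.
Qed.

End fixed_function.

Lemma nneseries_geometric_le (a r : R) : (0 <= a)%R -> (0 <= r < 1)%R ->
  \sum_(j <oo) (a * r ^+ j)%:E <= (a / (1 - r))%:E.
Proof.
move=> a0 /andP[r0 r1]; apply: lime_le.
  by apply: is_cvg_nneseries => j _ _; rewrite lee_fin mulr_ge0// exprn_ge0.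
apply: nearW => N; rewrite sumEFin lee_fin.
have /(congr1 (fun f => f N)) := @geometric_seriesE R a r (negbT (lt_eqF r1)).
rewrite /series/= => ->; rewrite ler_pM2r ?invr_gt0 ?subr_gt0//.
by rewrite ler_piMr// lerBlDr lerDl exprn_ge0.
Qed.

(** * From weak type bounds to uniformly small tails *)

Section tails.
Context {n : nat}.
Variables (u : n.-tuple R -> R) (mu : measurable_fun [set: n.-tuple R] u).

Lemma measurable_superlevel (la : R) : measurable [set x | (la < `|u x|)%R].
Proof.
rewrite (_ : mkset _ = (fun x => `|u x|)%R @^-1` `]la, +oo[%classic)%R; last first.
  by apply/seteqP; split => x /=; rewrite in_itv/= andbT.
rewrite -[X in measurable X]setTI.
by apply: (measurableT_comp (@normr_measurable R setT) mu).
Qed.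

(** Cut the range of |u| into the layers between 2 la and 4 la with la = 2^(J+j). On each, |u|^P is
    at most (4 la)^P and the weak bound costs K la^(-q), which leaves a geometric series of ratio
    2^(P-q) < 1. *)
Lemma tail_estimate (P q K la0 : R) (J : nat) :
  (0 < P)%R -> (P < q)%R -> (0 <= K)%R -> (la0 <= 2 ^+ J)%R ->
  (forall la : R, (la0 <= la)%R -> lebn n [set x | (2 * la < `|u x|)%R] <=
     (K * la `^ (- q))%:E) ->
  \int[lebn n]_x (\1_[set x | (2 * 2 ^+ J < `|u x|)%R] x * `|u x| `^ P)%:E <=
  (K * 4 `^ P * (2 `^ (P - q)) ^+ J / (1 - 2 `^ (P - q)))%:E.
Proof.
move=> P0 Pq K0 HJ Hw.
have r0 : (0 <= 2 `^ (P - q) :> R)%R by exact: powR_ge0.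
have r1 : (2 `^ (P - q) < 1 :> R)%R.
  by rewrite /powR pnatr_eq0/= expR_lt1 nmulr_rlt0 ?subr_lt0// ln_gt0// ltr1n.
pose la j : R := (2 ^+ (J + j))%R.
have la0' j : (0 < la j)%R by rewrite exprn_gt0.
pose E j := [set x | (2 * la j < `|u x|)%R].
have mE j : measurable (E j) by exact: measurable_superlevel.
pose g j x : \bar R := ((4 * la j) `^ P)%:E * (\1_(E j) x)%:E.
have g0 j x : 0 <= g j x by rewrite mule_ge0 ?lee_fin ?powR_ge0.
have mg j : measurable_fun [set: n.-tuple R] (g j).
  apply: emeasurable_funM; first exact: measurable_cst.
  by apply/measurable_EFinP; exact: measurable_indic.
have pw x : (\1_[set x | (2 * 2 ^+ J < `|u x|)%R] x * `|u x| `^ P)%:E <=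
    \sum_(j <oo) g j x.
  rewrite indicE; have [Ex|Ex] := pselect (2 * 2 ^+ J < `|u x|)%R; last first.
    rewrite memNset ?mul0r//; exact: nneseries_ge0.
  rewrite mem_set//= mul1r.
  have ex : exists k, (`|u x| <= 2 * la k)%R.
    exists (Num.truncn `|u x|).+1.
    have : (`|u x| < (Num.truncn `|u x|).+1%:R)%R by exact: truncnS_gt.
    move=> /ltW/le_trans; apply.
    apply: (@le_trans _ _ (2 ^+ (Num.truncn `|u x|).+1)%R).
      by rewrite -natrX ler_nat ltnW// ltn_expl.
    apply: (@le_trans _ _ (la (Num.truncn `|u x|).+1)).
      by rewrite /la exprD ler_peMl// ?exprn_ege1// ?ler1n// exprn_ge0.
    by rewrite ler_peMl// ?ler1n// ltW.
  (* The least index is positive since |u x| exceeds 2 * 2^J; its predecessor is the layer that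
     contains |u x|. *)
  case: (ex_minnP ex) => -[|k] Hk kmin.
    by exfalso; move: Hk; rewrite /la addn0 leNgt Ex.
  have Ek : (2 * la k < `|u x|)%R.
    by rewrite ltNge; apply/negP => /kmin; rewrite ltnn.
  apply: (@le_trans _ _ (g k x)).
    rewrite /g indicE mem_set// mule1 lee_fin.
    apply: ge0_ler_powR; rewrite ?nnegrE ?(ltW P0)//.
      by rewrite mulr_ge0// ltW.
    apply: le_trans Hk _; rewrite /la addnS exprS mulrA.
    by rewrite ler_wpM2r ?exprn_ge0// -natrM.
  apply: le_trans (nneseries_lim_ge k.+1 _) => //.
  rewrite big_nat_recr//= leeDr// sume_ge0//.
apply: (@le_trans _ _ (\int[lebn n]_x \sum_(j <oo) g j x)).
  apply: ge0_le_integralT => //.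
  - apply/measurable_EFinP; apply: measurable_funM.
      by apply: measurable_indic; exact: measurable_superlevel.
    by have /measurable_EFinP := measurable_powR_norm P mu.
  - exact: ge0_emeasurable_sum.
rewrite integral_nneseries//.
apply: le_trans (nneseries_geometric_le (a := K * 4 `^ P * (2 `^ (P - q)) ^+ J) (r := 2 `^ (P - q)) _ _); last 2 first.
- by rewrite !mulr_ge0 ?powR_ge0// exprn_ge0.
- by rewrite r0 r1.
apply: lee_nneseries => j _; first by move=> _; apply: integral_ge0.
rewrite ge0_integralTZl ?powR_ge0//; last first.
  by apply/measurable_EFinP; exact: measurable_indic.
rewrite integral_indic// setIT.
apply: (@le_trans _ _ (((4 * la j) `^ P)%:E * (K * la j `^ (- q))%:E)).
  apply: lee_wpmul2l; first by rewrite lee_fin powR_ge0.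
  apply: Hw; apply: le_trans HJ _.
  by rewrite /la exprD ler_peMr// ?exprn_ege1// ?ler1n// exprn_ge0.
rewrite -EFinM lee_fin powRM ?(ltW (la0' j))//.
rewrite -[X in (_ <= X)%R]mulrA -exprD -[(_ ^+ (J + j))%R]powR_mulrn ?powR_ge0//.
rewrite -powRrM.
have -> : (2 `^ ((P - q) * (J + j)%:R) = la j `^ P * la j `^ (- q))%R.
  rewrite -powRD; last by rewrite (gt_eqF (la0' j)) implybT.
  by rewrite /la -[in RHS]powR_mulrn// -powRrM mulrC.
by rewrite le_eqVlt; apply/orP; left; apply/eqP; ring.
Qed.

End tails.

(** The threshold [L] depends only on the constants of the weak bound and is chosen before u: this
    order of quantifiers is the uniform integrability. *)
Lemma uniform_tail (P q K la0 eta : R) :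
  (0 < P)%R -> (P < q)%R -> (0 <= K)%R -> (0 < eta)%R ->
  exists2 L : R, (0 < L)%R & forall n (u : n.-tuple R -> R),
    measurable_fun [set: n.-tuple R] u ->
    (forall la : R, (la0 <= la)%R -> lebn n [set x | (2 * la < `|u x|)%R] <=
       (K * la `^ (- q))%:E) ->
    \int[lebn n]_x (\1_[set x | (L < `|u x|)%R] x * `|u x| `^ P)%:E <= eta%:E.
Proof.
move=> P0 Pq K0 eta0.
have r0 : (0 <= 2 `^ (P - q) :> R)%R by exact: powR_ge0.
have r1 : (2 `^ (P - q) < 1 :> R)%R.
  by rewrite /powR pnatr_eq0/= expR_lt1 nmulr_rlt0 ?subr_lt0// ln_gt0// ltr1n.
have rcvg : (K * 4 `^ P / (1 - 2 `^ (P - q)) * (2 `^ (P - q)) ^+ J)%R @[J --> \oo] --> (0 : R)%R.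
  rewrite -[X in _ --> X](mulr0 (K * 4 `^ P / (1 - 2 `^ (P - q)))%R).
  by apply: cvgMr; apply: cvg_expr; rewrite ger0_norm.
have /cvgrPdist_lt/(_ _ eta0)[J0 _ HJ0] := rcvg.
pose J := maxn J0 (Num.truncn la0).+1.
exists (2 * 2 ^+ J)%R; first by rewrite mulr_gt0// exprn_gt0.
move=> n u mu Hw; apply: le_trans (tail_estimate mu P0 Pq K0 _ Hw) _.
  have : (la0 < (Num.truncn la0).+1%:R)%R by exact: truncnS_gt.
  move=> /ltW/le_trans; apply; rewrite -natrX ler_nat.
  by apply: leq_trans (leq_maxr J0 _) _; rewrite ltnW// ltn_expl.
have := HJ0 J (leq_maxl _ _); rewrite /= sub0r normrN lee_fin => /ltW.
move=> /(le_trans (ler_norm _)); apply: le_trans.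
by rewrite le_eqVlt; apply/orP; left; apply/eqP; rewrite mulrAC.
Qed.

End weak_type.

(** * Approximation by step functions *)

Section local_compactness.
Context {R : realType}.
Local Open Scope ereal_scope.

Section geometry.
Context {n : nat}.
Implicit Types (x z : n.-tuple R) (m M : nat).

(** Half-open on the same side as the cells of [corner], so that for every M it is exactly a union
    of cells. *)
Definition cubeK m : set (n.-tuple R) :=
  [set x | forall j, - m%:R < tnth x j <= m%:R]%R.

(* The lower corner of the half-open grid cell of side [1/M] containing [x]. *)
Definition corner M x : n.-tuple R :=
  [tuple ((Num.ceil (tnth x j * M%:R) - 1)%:~R / M%:R)%R | j < n].

Lemma corner_itv M x j : (0 < M)%N ->
  (tnth (corner M x) j < tnth x j <= tnth (corner M x) j + M%:R^-1)%R.
Proof.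
move=> M0; rewrite tnth_mktuple.
have M0' : (0 < M%:R :> R)%R by rewrite ltr0n.
have /andP[h1 h2] := ceil_itv (tnth x j * M%:R).
rewrite ltr_pdivrMr// h1/= -[X in (_ <= _ + X)%R]mul1r -mulrDl ler_pdivlMr//.
by apply: le_trans h2 _; rewrite rmorphB/= subrK.
Qed.

Lemma measurable_corner M : measurable_fun [set: n.-tuple R] (corner M).
Proof.
apply/measurable_fun_tnthP => j.
have mc : measurable_fun [set: R]
    (fun t : R => (Num.ceil (t * M%:R) - 1)%:~R / M%:R : R)%R.
  apply: nondecreasing_measurable => // a b ab.
  apply: ler_wpM2r; first by rewrite invr_ge0.
  by rewrite ler_int lerD2r; apply: le_ceil; apply: ler_wpM2r.
apply: eq_measurable_fun (measurableT_comp mc (@measurable_tnth _ R n j)) => x _ /=.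
by rewrite tnth_mktuple.
Qed.

Lemma cube_ceil (t : R) m M : (0 < M)%N ->
  (- m%:R < t <= m%:R)%R =
  (- (m * M)%:Z < Num.ceil (t * M%:R) <= (m * M)%:Z)%R.
Proof.
move=> M0; have M0' : (0 < M%:R :> R)%R by rewrite ltr0n.
rewrite ceil_gt_int ceil_le_int rmorphN/= -!pmulrn natrM -mulNr.
by rewrite ltr_pM2r// ler_pM2r.
Qed.

(** The box with sides 4m has coordinates in []2m, 4m]], so the cube is a translate of it and
    inherits its measurability and volume. *)
Lemma cubeKE m x :
  cubeK m x <-> box (fun=> 4 * m%:R)%R (addRn x (fun=> 3 * m%:R)%R).
Proof.
by split=> h j; have := h j; rewrite tnth_mktuple => /andP[h1 h2];
  apply/andP; split; lra.
Qed.

Lemma indic_cubeK m x :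
  \1_(cubeK m) x = \1_(box (fun=> 4 * m%:R)%R) (addRn x (fun=> 3 * m%:R)%R) :> R.
Proof.
rewrite !indicE; congr (nat_of_bool _)%:R.
by apply/idP/idP => /set_mem h; apply/mem_set; apply/cubeKE.
Qed.

Lemma measurable_indic_cubeK m :
  measurable_fun [set: n.-tuple R] (\1_(cubeK m) : n.-tuple R -> R).
Proof.
rewrite (_ : \1_(cubeK m) = \1_(box (fun=> 4 * m%:R)%R) \o
    (fun x => addRn x (fun=> 3 * m%:R)%R)); last first.
  by apply/funext => x; exact: indic_cubeK.
apply: (measurableT_comp (measurable_indic_box _)).
by apply: measurable_addRn => // j; exact: measurable_cst.
Qed.

Lemma integral_cubeK m : (0 < m)%N ->
  \int[lebn n]_x (\1_(cubeK m) x)%:E = (vol (fun _ : 'I_n => 4 * m%:R))%:E.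
Proof.
move=> m0; under eq_integral do rewrite indic_cubeK.
rewrite (ge0_integral_addRn (f := fun x => (\1_(box (fun=> 4 * m%:R)%R) x)%:E)).
- by rewrite integral_box// => j; rewrite mulr_gt0// ltr0n.
- by apply/measurable_EFinP; exact: measurable_indic_box.
- by move=> x; rewrite lee_fin.
Qed.

Lemma cubeK_corner m M x z : (0 < M)%N ->
  corner M x = corner M z -> cubeK m z -> cubeK m x.
Proof.
move=> M0 xz Kz j; have M0' : (0 < M%:R :> R)%R by rewrite ltr0n.
have cE : Num.ceil (tnth x j * M%:R) = Num.ceil (tnth z j * M%:R).
  have := congr1 (fun t => tnth t j) xz; rewrite !tnth_mktuple.
  have Mn0 : (M%:R^-1 != 0 :> R)%R by rewrite invr_eq0 gt_eqF.
  by move=> /(mulIf Mn0)/intr_inj/addIr.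
by rewrite (cube_ceil _ _ M0) cE -(cube_ceil _ _ M0); exact: Kz.
Qed.

Lemma corner_finite m M : (0 < M)%N ->
  exists f : {ffun 'I_n -> 'I_(2 * m * M)} -> n.-tuple R,
    forall x, cubeK m x -> exists c, corner M x = f c.
Proof.
move=> M0; have M0' : (0 < M%:R :> R)%R by rewrite ltr0n.
exists (fun c : {ffun 'I_n -> 'I_(2 * m * M)} =>
  [tuple (((c j)%:R - (m * M)%:R) / M%:R)%R | j < n]) => x Kx.
(* On the cube the ceiling lies in []-mM, mM]]; subtracting 1 and adding mM lands in [[0, 2mM[], the
   range of the index. *)
have z0 (j : 'I_n) : (0 <= Num.ceil (tnth x j * M%:R)%R - 1 + (m * M)%:Z)%R.
  by have := Kx j; rewrite (cube_ceil _ _ M0); move: (Num.ceil _) => c /andP[]; lia.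
have a_lt (j : 'I_n) :
   (`|(Num.ceil (tnth x j * M%:R)%R - 1 + (m * M)%:Z)%R| < 2 * m * M)%N.
  by have := z0 j; have := Kx j; rewrite (cube_ceil _ _ M0);
    move: (Num.ceil _) => c /andP[]; lia.
exists [ffun j => Ordinal (a_lt j)]; apply: eq_from_tnth => j.
rewrite !tnth_mktuple ffunE/= natr_absz (ger0_norm (z0 j)).
by rewrite [in RHS]rmorphD/= [X in (_ + X - _)%R](_ : _ = (m * M)%:R)%R ?addrK.
Qed.

End geometry.

(** * Sampling a measurable function at grid corners *)

Section sampling.
Context {n : nat}.
Variables (u : n.-tuple R -> R) (mu : measurable_fun [set: n.-tuple R] u).
Variables (p sig : 'I_n -> R) (C : R).
Hypothesis Hu : anisotropic_bound u p sig C.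

(* With [d = 1/M] and [k] in [box 2d], the shift by [2d] puts [corner M x + k + 2d] in
   [x + box 4d], where the anisotropic bound controls the differences of [u]. *)
Definition sample (d : R) (k z : n.-tuple R) : R :=
  u (addRn (addRn z (tnth k)) (fun=> 2 * d)%R).

Lemma measurable_sample_corner d M : measurable_fun
  [set: (n.-tuple R * n.-tuple R)%type] (fun z => sample d z.1 (corner M z.2)).
Proof.
apply: (measurableT_comp mu); apply: measurable_addRn; last first.
  by move=> j; exact: measurable_cst.
apply: measurable_addRn.
  exact: (measurableT_comp (measurable_corner M) measurable_snd).
by move=> j; exact: (measurableT_comp (@measurable_tnth _ R n j) measurable_fst).
Qed.

(** For fixed x, translation of the offset k turns the sampled value into u(x + h), with h in the
    box of side 4/M. Averaging over k is essential: the values of a measurable function at the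
    corners themselves carry no information. *)
Lemma sampling_average m M : (0 < M)%N ->
  \int[lebn n]_k ((\1_(box (fun=> 2 * M%:R^-1)%R) k)%:E *
     \int[lebn n]_x (\1_(cubeK m) x * `|u x - sample M%:R^-1 k (corner M x)|)%:E) <=
  \int[lebn n]_x \int[lebn n]_h (\1_(cubeK m) x *
     (\1_(box (fun=> 4 * M%:R^-1)%R) h * `|u (addRn x (tnth h)) - u x|))%:E.
Proof.
move=> M0; set d := (M%:R^-1)%R.
have md : measurable_fun [set: (n.-tuple R * n.-tuple R)%type]
    (fun z => (\1_(cubeK m) z.2 * `|u z.2 - sample d z.1 (corner M z.2)|)%R).
  apply: measurable_funM.
    exact: (measurableT_comp (measurable_indic_cubeK m) measurable_snd).
  apply: (measurableT_comp (@normr_measurable R setT)).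
  apply: measurable_funB; last exact: measurable_sample_corner.
  exact: (measurableT_comp mu measurable_snd).
pose f (z : n.-tuple R * n.-tuple R) : \bar R :=
  (\1_(box (fun=> 2 * d)%R) z.1)%:E *
  (\1_(cubeK m) z.2 * `|u z.2 - sample d z.1 (corner M z.2)|)%:E.
have f0 z : 0 <= f z by rewrite mule_ge0// lee_fin.
have mf : measurable_fun setT f.
  apply: emeasurable_funM; apply/measurable_EFinP => //.
  exact: (measurableT_comp (measurable_indic_box _) measurable_fst).
under eq_integral => k _.
  rewrite -ge0_integralTZl//; last first.
    by apply/measurable_EFinP; exact: (measurable_fun_pair2 k md).
  over.
rewrite (fubini_tonelli (m1 := lebn n) (m2 := lebn n) f)//.
pose g (z : n.-tuple R * n.-tuple R) : \bar R := (\1_(cubeK m) z.1 *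
     (\1_(box (fun=> 4 * d)%R) z.2 * `|u (addRn z.1 (tnth z.2)) - u z.1|))%:E.
have g0 z : 0 <= g z by rewrite lee_fin !mulr_ge0.
have mg : measurable_fun setT g.
  apply/measurable_EFinP; apply: measurable_funM.
    exact: (measurableT_comp (measurable_indic_cubeK m) measurable_fst).
  apply: measurable_funM.
    exact: (measurableT_comp (measurable_indic_box _) measurable_snd).
  apply: (measurableT_comp (@normr_measurable R setT)).
  apply: measurable_funB; last exact: (measurableT_comp mu measurable_fst).
  apply: (measurableT_comp mu); apply: measurable_addRn => // j.
  exact: (measurableT_comp (@measurable_tnth _ R n j) measurable_snd).
apply: ge0_le_integralT.
- exact: (measurable_fun_fubini_tonelli_G (m1 := lebn n) f).
- exact: (measurable_fun_fubini_tonelli_F (m2 := lebn n) g).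
- by move=> x; apply: integral_ge0.
(* As [corner M x - x] lies in [[-d, 0[] and k in []d, 2d]] coordinatewise, k + e lies in []2d,
   4d]]. *)
move=> x; pose e j := (tnth (corner M x) j - tnth x j + 2 * d)%R.
have mgx : measurable_fun [set: n.-tuple R] (fun h => g (x, h)).
  exact: (measurable_fun_pair2 x mg).
rewrite -(ge0_integral_addRn e mgx)//.
apply: ge0_le_integralT => //.
- exact: (measurable_fun_pair1 x mf).
- have m1 : measurable_fun [set: n.-tuple R] (fun h => addRn h e).
    by apply: measurable_addRn => // j; exact: measurable_cst.
  exact: (measurableT_comp mgx m1).
move=> k; rewrite /f /g/= -EFinM lee_fin mulrCA; apply: ler_wpM2l => //.
have -> : sample d k (corner M x) = u (addRn x (tnth (addRn k e))).
  rewrite /sample; congr u; apply: eq_from_tnth => j.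
  by rewrite !tnth_addRn /e; ring.
rewrite distrC; apply: ler_wpM2r => //.
rewrite !indicE ler_nat; case: (pselect (box (fun=> 2 * d)%R k)) => hk; last first.
  by rewrite memNset.
rewrite [X in (_ <= nat_of_bool X)%N]mem_set ?leq_b1// => j.
have := hk j; have := corner_itv x j M0; rewrite tnth_addRn /e -/d.
move=> /andP[c1 c2] /andP[k1 k2]; apply/andP; split; lra.
Qed.

(** Where a > e, write a = a^(1-q) a^q. This additive substitute for Hölder's inequality lets
    directions with different exponents be summed. *)
Lemma le_young (e a q : R) : (0 < e)%R -> (0 <= a)%R -> (1 <= q)%R ->
  (a <= e + e `^ (1 - q) * a `^ q)%R.
Proof.
move=> e0 a0 q1; have [ae|ea] := leP a e.
  by apply: ler_wpDr => //; rewrite mulr_ge0// powR_ge0.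
have a0' : (0 < a)%R by apply: lt_trans ea.
apply: ler_wpDl; first exact: ltW.
apply: (@le_trans _ _ (a `^ (1 - q) * a `^ q)%R).
  by rewrite -powRD ?subrK ?powRr1// (gt_eqF a0') implybT.
apply: ler_wpM2r; first exact: powR_ge0.
rewrite -(opprB q 1%R) !powRN lef_pV2 ?posrE ?powR_gt0//.
by apply: ge0_ler_powR; rewrite ?nnegrE ?subr_ge0// ltW.
Qed.

(** [le_young] bounds each step by the constant [e], integrated over cube times box, plus a power,
    integrated over the whole space by [box_wstep_estimate] with weights e^(1-p_i). *)
Lemma box_difference_average m (d e : R) : (0 < m)%N -> (0 < d)%R -> (4 * d <= 1)%R ->
  (0 < e)%R -> (forall i, 1 <= p i)%R ->
  \int[lebn n]_x \int[lebn n]_h (\1_(cubeK m) x *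
     (\1_(box (fun=> 4 * d)%R) h * `|u (addRn x (tnth h)) - u x|))%:E <=
  (vol (fun _ : 'I_n => 4 * d) * (n%:R * e * vol (fun _ : 'I_n => 4 * m%:R) +
     \sum_(i < n) e `^ (1 - p i) * (2 * C * (4 * d) `^ (sig i * p i))))%:E.
Proof.
move=> m0 d0 d1 e0 p1.
pose c i : R := (e `^ (1 - p i))%R.
have c0 i : (0 <= c i)%R by rewrite powR_ge0.
have d40 : (0 < 4 * d)%R by rewrite mulr_gt0.
have mb : measurable_fun [set: n.-tuple R] (fun h => (\1_(box (fun=> 4 * d)%R) h : R)%:E).
  by apply/measurable_EFinP; exact: measurable_indic_box.
pose A (z : n.-tuple R * n.-tuple R) : \bar R :=
  (n%:R * e * \1_(cubeK m) z.1)%:E * (\1_(box (fun=> 4 * d)%R) z.2)%:E.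
pose B (z : n.-tuple R * n.-tuple R) : \bar R :=
  (\1_(box (fun=> 4 * d)%R) z.2 * wstep u p c z.1 z.2)%:E.
pose g (z : n.-tuple R * n.-tuple R) : \bar R := (\1_(cubeK m) z.1 *
     (\1_(box (fun=> 4 * d)%R) z.2 * `|u (addRn z.1 (tnth z.2)) - u z.1|))%:E.
have g0 z : 0 <= g z by rewrite lee_fin !mulr_ge0.
have A0 z : 0 <= A z by rewrite mule_ge0// lee_fin !mulr_ge0// ltW.
have B0 z : 0 <= B z by rewrite lee_fin mulr_ge0// wstep_ge0.
have mK : measurable_fun [set: (n.-tuple R * n.-tuple R)%type] (fun z => \1_(cubeK m) z.1 : R).
  exact: (measurableT_comp (measurable_indic_cubeK m) measurable_fst).
have mb2 : measurable_fun [set: (n.-tuple R * n.-tuple R)%type]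
    (fun z => \1_(box (fun=> 4 * d)%R) z.2 : R).
  exact: (measurableT_comp (measurable_indic_box _) measurable_snd).
have mg : measurable_fun setT g.
  apply/measurable_EFinP; apply: measurable_funM => //.
  apply: measurable_funM => //.
  apply: (measurableT_comp (@normr_measurable R setT)).
  apply: measurable_funB; last exact: (measurableT_comp mu measurable_fst).
  apply: (measurableT_comp mu); apply: measurable_addRn => // j.
  exact: (measurableT_comp (@measurable_tnth _ R n j) measurable_snd).
have mA : measurable_fun setT A.
  apply: emeasurable_funM; apply/measurable_EFinP => //.
  by apply: measurable_funM => //; exact: measurable_cst.
have mB : measurable_fun setT B.
  apply/measurable_EFinP; apply: measurable_funM => //.
  have := measurableT_comp (measurable_wstep mu p c) (@measurable_swap _ _ (n.-tuple R) (n.-tuple R)).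
  exact.
have pw x h : g (x, h) <= A (x, h) + B (x, h).
  rewrite /g /A /B/= -EFinM -EFinD lee_fin.
  have [hb|hb] := pselect (box (fun=> 4 * d)%R h); last first.
    by rewrite !indicE (memNset hb) !mul0r !mulr0 addr0.
  have [xK|xK] := pselect (cubeK m x); last first.
    by rewrite !indicE (memNset xK) !mul0r mulr0 mul0r add0r mulr_ge0// wstep_ge0.
  rewrite !indicE !mem_set// !mul1r !mulr1.
  apply: le_trans (step_telescope u x h) _.
  rewrite (_ : n%:R * e = \sum_(i < n) e)%R; last by rewrite sumr_const card_ord mulr_natl.
  rewrite -big_split/=; apply: ler_sum => i _; exact: le_young.
apply: (@le_trans _ _ (\int[lebn n]_x \int[lebn n]_h (A (x, h) + B (x, h)))).
  have mAB : measurable_fun setT (A \+ B) by exact: emeasurable_funD.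
  apply: ge0_le_integralT.
  - exact: (measurable_fun_fubini_tonelli_F (m2 := lebn n) g).
  - apply: (measurable_fun_fubini_tonelli_F (m2 := lebn n) (A \+ B)) => //.
    by move=> z; rewrite adde_ge0.
  - by move=> x; apply: integral_ge0.
  move=> x; apply: ge0_le_integralT => //.
  - exact: (measurable_fun_pair2 x mg).
  - exact: (measurable_fun_pair2 x mAB).
  - by move=> h; exact: pw.
under eq_integral => x _.
  rewrite ge0_integralTD//; last 2 first.
  - exact: (measurable_fun_pair2 x mA).
  - exact: (measurable_fun_pair2 x mB).
  rewrite /A/= ge0_integralTZl//; last by rewrite !mulr_ge0// ltW.
  rewrite integral_box//.
  over.
rewrite ge0_integralTD//; last 4 first.
- apply: emeasurable_funM => //; apply/measurable_EFinP.
  by apply: measurable_funM => //; exact: measurable_indic_cubeK.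
- exact: (measurable_fun_fubini_tonelli_F (m2 := lebn n) B).
- by move=> x; rewrite mule_ge0// lee_fin ?(ltW (vol_gt0 _))// !mulr_ge0// ltW.
- by move=> x; apply: integral_ge0.
rewrite mulrDr EFinD; apply: leeD; last first.
  by apply: (box_wstep_estimate mu Hu) => // j; rewrite d40.
under eq_integral do rewrite -EFinM mulrAC EFinM.
rewrite ge0_integralTZl//; last 2 first.
- by apply/measurable_EFinP; exact: measurable_indic_cubeK.
- by rewrite !mulr_ge0 ?(ltW (vol_gt0 _))// ltW.
rewrite integral_cubeK// -EFinM lee_fin le_eqVlt; apply/orP; left; apply/eqP; ring.
Qed.

End sampling.
Lemma near_powR_inv_le (a e : R) : (0 < a)%R -> (0 < e)%R ->
  \forall M \near \oo, ((4 * M%:R^-1) `^ a <= e)%R.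
Proof.
move=> a0 e0; pose b : R := (e `^ a^-1)%R.
have b0 : (0 < b)%R by exact: powR_gt0.
exists (Num.truncn (4 / b)).+1 => // M /= NM.
have M4 : (4 / b < M%:R)%R.
  have h : (4 / b < (Num.truncn (4 / b)).+1%:R)%R by exact: truncnS_gt.
  by apply: lt_le_trans h _; rewrite ler_nat.
have M0 : (0 < M%:R :> R)%R by apply: le_lt_trans M4; rewrite divr_ge0// ltW.
rewrite (_ : e = b `^ a)%R; last by rewrite -powRrM mulVf ?powRr1 ?gt_eqF// ltW.
apply: ge0_ler_powR; rewrite ?nnegrE ?(ltW a0) ?(ltW b0) ?mulr_ge0 ?invr_ge0 ?(ltW M0)//.
by rewrite ler_pdivrMr// mulrC -ler_pdivrMr// ltW.
Qed.

Lemma step_approximation n (p sig : 'I_n -> R) (C : R) m (eta : R) :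
  (0 < m)%N -> (0 < eta)%R -> (0 <= C)%R ->
  (forall i, 1 < p i)%R -> (forall i, 0 < sig i)%R ->
  exists2 M, (0 < M)%N & forall u : n.-tuple R -> R,
    measurable_fun [set: n.-tuple R] u -> anisotropic_bound u p sig C ->
    exists k, \int[lebn n]_x (\1_(cubeK m) x *
      `|u x - sample u M%:R^-1 k (corner M x)|)%:E <= eta%:E.
Proof.
move=> m0 eta0 C0 p1 sig0.
pose V : R := vol (fun _ : 'I_n => 4 * m%:R)%R.
have V0 : (0 <= V)%R by apply/ltW/vol_gt0 => j; rewrite mulr_gt0// ltr0n.
(* First [e] brings the cube term below eta/4; the mesh is then refined until the power term, whose
   weights depend on [e], is below eta/4 too. The factor 2^n is the ratio of the volumes of the
   boxes of sides 4/M and 2/M. *)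
pose e : R := (eta / (4 * 2 ^+ n * (n%:R * V + 1)))%R.
have W0 : (0 < 4 * 2 ^+ n * (n%:R * V + 1))%R.
  by rewrite !mulr_gt0// ?exprn_gt0// ltr_wpDl// mulr_ge0.
have e0 : (0 < e)%R by rewrite divr_gt0.
pose S : R := (\sum_(i < n) e `^ (1 - p i) * (2 * C))%R.
have S0 : (0 <= S)%R by apply: sumr_ge0 => i _; rewrite !mulr_ge0// powR_ge0.
pose e' : R := (eta / (4 * 2 ^+ n * (S + 1)))%R.
have W'0 : (0 < 4 * 2 ^+ n * (S + 1))%R.
  by rewrite !mulr_gt0// ?exprn_gt0// ltr_wpDl.
have e'0 : (0 < e')%R by rewrite divr_gt0.
have HM : \forall M \near \oo, [forall i, ((4 * M%:R^-1) `^ (sig i * p i) <= e')%R]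
    /\ (4 <= M)%N.
  apply: filterI; last by exists 4%N.
  have H (i : 'I_n) : \forall M \near \oo, ((4 * M%:R^-1) `^ (sig i * p i) <= e')%R.
    by apply: near_powR_inv_le => //; rewrite mulr_gt0// (lt_trans _ (p1 i)).
  by apply: filterS (filter_forall _ H) => M HM; apply/forallP.
have [M [/forallP HMi M4]] := filter_ex HM.
have M0 : (0 < M)%N by apply: leq_trans M4.
have M0' : (0 < M%:R :> R)%R by rewrite ltr0n.
exists M => // u mu Hu; set d := (M%:R^-1)%R.
have d0 : (0 < d)%R by rewrite invr_gt0.
have d1 : (4 * d <= 1)%R by rewrite ler_pdivrMr// mul1r (ler_nat R 4).
have V2 : vol (fun _ : 'I_n => 4 * d)%R = (2 ^+ n * vol (fun _ : 'I_n => 2 * d))%R.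
  by rewrite /vol !prodr_const card_ord -exprMn; congr (_ ^+ _)%R; field.
pose v : R := vol (fun _ : 'I_n => 2 * d)%R.
have v0 : (0 < v)%R by apply: vol_gt0 => j; rewrite mulr_gt0.
(* First moment argument: if every offset had error above eta, so would the average over the box of
   offsets, which is at most eta/2. *)
apply/not_existsP => Hk.
have mPhi : measurable_fun [set: n.-tuple R] (fun k => \int[lebn n]_x
    (\1_(cubeK m) x * `|u x - sample u d k (corner M x)|)%:E).
  apply: (measurable_fun_fubini_tonelli_F (m2 := lebn n) (fun z =>
     (\1_(cubeK m) z.2 * `|u z.2 - sample u d z.1 (corner M z.2)|)%:E)).
    apply/measurable_EFinP; apply: measurable_funM.
      exact: (measurableT_comp (measurable_indic_cubeK m) measurable_snd).
    apply: (measurableT_comp (@normr_measurable R setT)).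
    apply: measurable_funB; last exact: measurable_sample_corner.
    exact: (measurableT_comp mu measurable_snd).
  by move=> z; rewrite lee_fin mulr_ge0.
have mb : measurable_fun [set: n.-tuple R] (fun h => (\1_(box (fun=> 2 * d)%R) h : R)%:E).
  by apply/measurable_EFinP; exact: measurable_indic_box.
have H1 : (eta * v)%:E <= \int[lebn n]_k ((\1_(box (fun=> 2 * d)%R) k)%:E *
     \int[lebn n]_x (\1_(cubeK m) x * `|u x - sample u d k (corner M x)|)%:E).
  rewrite EFinM /v -integral_box; last by move=> j; rewrite mulr_gt0.
  rewrite -ge0_integralTZl//; last exact: ltW.
  apply: ge0_le_integralT => //.
  - by apply: emeasurable_funM => //; exact: measurable_cst.
  - exact: emeasurable_funM.
  - by move=> k; rewrite mule_ge0// lee_fin ltW.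
  move=> k; rewrite muleC; apply: lee_wpmul2l; first by rewrite lee_fin.
  by rewrite leNgt; apply/negP => /ltW; exact: Hk.
have := le_trans H1 (le_trans (sampling_average mu m M0)
  (box_difference_average mu Hu m0 d0 d1 e0 (fun i => ltW (p1 i)))).
rewrite lee_fin V2 -/v -/V (mulrAC (2 ^+ n)%R) ler_pM2r// leNgt => /negP; apply.
have h1 : (2 ^+ n * (n%:R * e * V) <= eta / 4)%R.
  rewrite (_ : eta / 4 = 2 ^+ n * (e * (n%:R * V + 1)))%R; last first.
    rewrite /e; field.
    by rewrite expf_neq0//= gt_eqF// ltr_wpDl// mulr_ge0.
  rewrite ler_pM2l ?exprn_gt0// (mulrC n%:R) -mulrA.
  by apply: ler_wpM2l; [exact: ltW|rewrite lerDl].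
have h2 : (2 ^+ n * (\sum_(i < n) e `^ (1 - p i) * (2 * C * (4 * d) `^ (sig i * p i)))
    <= eta / 4)%R.
  apply: (@le_trans _ _ (2 ^+ n * (S * e'))%R).
    apply: ler_wpM2l; first exact: exprn_ge0.
    rewrite /S mulr_suml; apply: ler_sum => i _; rewrite -[leRHS]mulrA.
    apply: ler_wpM2l; first exact: powR_ge0.
    by apply: ler_wpM2l; [rewrite mulr_ge0|exact: HMi].
  rewrite (_ : eta / 4 = 2 ^+ n * ((S + 1) * e'))%R; last first.
    rewrite /e'; field.
    by rewrite expf_neq0//= gt_eqF// ltr_wpDl.
  rewrite ler_pM2l ?exprn_gt0//.
  by apply: ler_wpM2r; [exact: ltW|rewrite lerDl].
rewrite mulrDr; lra.
Qed.

End local_compactness.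

(** * Compactness along an ultrafilter *)

Section cauchy.
Context {R : realType}.
Local Open Scope ereal_scope.

(** By compactness the image filter has a cluster point a in the segment. The ultrafilter contains
    either the set of indices with values near a or its complement, and the latter would contradict
    clustering. *)
Lemma ultra_bounded (U : set_system nat) (f : nat -> R) (B e : R) :
  UltraFilter U -> (0 < e)%R -> U [set k | (`|f k| <= B)%R] ->
  exists a : R, U [set k | (`|f k - a| <= e)%R].
Proof.
move=> UU e0 UB.
have UP : ProperFilter U by exact: ultra_proper.
have FB : (f @ U) `[(- B)%R, B]%classic.
  rewrite /fmap/=; apply: filterS UB => k /= Hk.
  by rewrite in_itv/= -ler_norml.
have [a [_ cla]] := @segment_compact R (- B)%R B (f @ U) _ FB.
exists a; have [//|Uc] := in_ultra_setVsetC [set k | (`|f k - a| <= e)%R] UU.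
have [y [/= yN ya]] : [set y | ~ (`|y - a| <= e)%R] `&` ball a e !=set0.
  by apply: cla; [exact: Uc|exact: nbhsx_ballx].
by exfalso; apply: yN; rewrite distrC ltW.
Qed.

Lemma normr_le1D_powR (P a : R) : (1 <= P)%R -> (`|a| <= 1 + `|a| `^ P)%R.
Proof.
move=> P1; have [a1|a1] := leP `|a|%R 1%R.
  by apply: ler_wpDr => //; exact: powR_ge0.
apply: ler_wpDl => //; rewrite -[leLHS]powRr1//.
by apply: ler_powR => //; exact: ltW.
Qed.

Section sequence.
Context {n : nat}.
Variables (p sig : 'I_n -> R) (C P N : R).
Hypotheses (C0 : (0 <= C)%R) (p1 : forall i, (1 < p i)%R).
Hypotheses (sig0 : forall i, (0 < sig i)%R) (P1 : (1 <= P)%R).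

Definition admissible (u : n.-tuple R -> R) :=
  [/\ measurable_fun [set: n.-tuple R] u, anisotropic_bound u p sig C &
      pint P u <= N%:E].

(** The step function is constant on the cell of x0, so its value there times the cell volume is at
    most an L^1 norm, within eta of that of u on the cube; and |u| <= 1 + |u|^P. The cell volume
    M^(-n) is written as the volume of a box of side 2/M. *)
Lemma sample_bounded m M (eta : R) u k x0 : (0 < m)%N -> (0 < M)%N ->
  (0 <= eta)%R -> admissible u -> cubeK m x0 ->
  \int[lebn n]_x (\1_(cubeK m) x *
      `|u x - sample u M%:R^-1 k (corner M x)|)%:E <= eta%:E ->
  (`|sample u M%:R^-1 k (corner M x0)| <=
    (eta + vol (fun _ : 'I_n => 4 * m%:R) + N) / vol (fun _ : 'I_n => 2 * M%:R^-1))%R.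
Proof.
move=> m0 M0 eta0 [mu Hu HN] Kx0 Heta.
set y := sample _ _ _ _; set d := (M%:R^-1)%R.
have M0' : (0 < M%:R :> R)%R by rewrite ltr0n.
have d0 : (0 < d)%R by rewrite invr_gt0.
have v0 : (0 < vol (fun _ : 'I_n => 2 * d))%R by apply: vol_gt0 => j; rewrite mulr_gt0.
rewrite ler_pdivlMr// -lee_fin EFinM -integral_box; last by move=> j; rewrite mulr_gt0.
(* Translation by e carries the cell []c, c + d]] of x0 onto the layer []d, 2d]]. *)
pose e j := (d - tnth (corner M x0) j)%R.
have mb : measurable_fun [set: n.-tuple R] (fun h => (\1_(box (fun=> 2 * d)%R) h : R)%:E).
  by apply/measurable_EFinP; exact: measurable_indic_box.
have mbe : measurable_fun [set: n.-tuple R]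
    (fun x => (\1_(box (fun=> 2 * d)%R) (addRn x e) : R)%:E).
  have m1 : measurable_fun [set: n.-tuple R] (fun x => addRn x e).
    by apply: measurable_addRn => // j; exact: measurable_cst.
  exact: (measurableT_comp mb m1).
rewrite -(ge0_integral_addRn e mb)// -ge0_integralTZl//.
have mK : measurable_fun [set: n.-tuple R] (fun x => (\1_(cubeK m) x : R)%:E).
  by apply/measurable_EFinP; exact: measurable_indic_cubeK.
have mD : measurable_fun [set: n.-tuple R] (fun x =>
    (\1_(cubeK m) x * `|u x - sample u d k (corner M x)|)%:E).
  apply/measurable_EFinP; apply: measurable_funM; first exact: measurable_indic_cubeK.
  apply: (measurableT_comp (@normr_measurable R setT)).
  apply: measurable_funB => //.
  exact: (measurable_fun_pair2 k (measurable_sample_corner mu d M)).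
have mp : measurable_fun [set: n.-tuple R] (fun x => (`|u x| `^ P)%:E).
  exact: measurable_powR_norm.
apply: (@le_trans _ _ (\int[lebn n]_x
    ((\1_(cubeK m) x * `|u x - sample u d k (corner M x)|)%:E +
     ((\1_(cubeK m) x)%:E + (`|u x| `^ P)%:E)))).
  apply: ge0_le_integralT => //.
  - by apply: emeasurable_funM => //; exact: measurable_cst.
  - by apply: emeasurable_funD => //; exact: emeasurable_funD.
  move=> x; rewrite -EFinM -!EFinD lee_fin indicE.
  have [hx|hx] := pselect (box (fun=> 2 * d)%R (addRn x e)); last first.
    by rewrite memNset// mulr0 !addr_ge0 ?mulr_ge0 ?powR_ge0.
  have cx : corner M x = corner M x0.
    apply: eq_from_tnth => j; rewrite !tnth_mktuple; congr (_%:~R / _)%R.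
    congr (_ - _)%R; apply/eqP; rewrite ceil_eq.
    have := hx j; rewrite tnth_addRn /e tnth_mktuple -/d => /andP[h1 h2].
    move: h1 h2; set c := Num.ceil _ => h1 h2.
    apply/andP; split; first by rewrite -ltr_pdivrMr// -/d; lra.
    rewrite -ler_pdivlMr// -/d (_ : c%:~R = (c - 1)%:~R + 1 :> R)%R.
      by rewrite mulrDl mul1r; lra.
    by rewrite rmorphB/= subrK.
  have Kx : cubeK m x by exact: cubeK_corner cx Kx0.
  rewrite mem_set// mulr1 indicE mem_set// mul1r cx -/y.
  apply: (@le_trans _ _ (`|u x - y| + `|u x|)%R).
    by rewrite distrC -{1}(subrK (u x) y) ler_normD.
  by rewrite lerD2l; exact: normr_le1D_powR.
rewrite ge0_integralTD//; last 2 first.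
- exact: emeasurable_funD.
- by move=> x; rewrite adde_ge0// lee_fin ?powR_ge0.
rewrite ge0_integralTD//.
rewrite integral_cubeK//.
rewrite !EFinD -addeA; apply: leeD => //.
by apply: leeD => //; rewrite -intRnE.
Qed.

Lemma L1_cauchy (U : set_system nat) (u : nat -> n.-tuple R -> R) m (eta : R) :
  UltraFilter U -> U [set k | admissible (u k)] -> (0 < m)%N -> (0 < eta)%R ->
  exists2 S, U S & forall k l, S k -> S l ->
    \int[lebn n]_x (\1_(cubeK m) x * `|u k x - u l x|)%:E <= eta%:E.
Proof.
move=> UU Uadm m0 eta0.
have UP : ProperFilter U by exact: ultra_proper.
have eta4 : (0 < eta / 4)%R by rewrite divr_gt0.
have [M M0 HM] := step_approximation m0 eta4 C0 p1 sig0.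
(* The implication makes the statement hold for every k, so that the offsets can be chosen as one
   function [kap]. *)
have Hex k : exists z, admissible (u k) -> \int[lebn n]_x (\1_(cubeK m) x *
    `|u k x - sample (u k) M%:R^-1 z (corner M x)|)%:E <= (eta / 4)%:E.
  have [[mu Hu _]|nadm] := pselect (admissible (u k)).
    by have [z Hz] := HM _ mu Hu; exists z.
  by exists [tuple 0%R | _ < n].
have [kap Hkap] := choice Hex.
have [f Hf] := corner_finite (n := n) (R := R) m M0.
pose V : R := vol (fun _ : 'I_n => 4 * m%:R)%R.
have V0 : (0 <= V)%R by apply/ltW/vol_gt0 => j; rewrite mulr_gt0// ltr0n.
(* Two approximation errors of eta/4, plus twice the distance [e] to the common cell value over a
   cube of volume [V]. *)
pose e : R := (eta / (4 * (V + 1)))%R.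
have e0 : (0 < e)%R by rewrite divr_gt0// mulr_gt0// ltr_wpDl.
(* [sample_bounded] speaks only of cells that meet the cube, hence the premise inside the set. *)
have Hc (c : {ffun 'I_n -> 'I_(2 * m * M)}) : exists a : R,
    U [set k | (exists2 x, cubeK m x & corner M x = f c) ->
       (`|sample (u k) M%:R^-1 (kap k) (f c) - a| <= e)%R].
  have [[x0 Kx0 cx0]|nc] := pselect (exists2 x, cubeK m x & corner M x = f c); last first.
    by exists 0%R; apply: filterS filterT => k _ /= /nc.
  have [|a Ha] := @ultra_bounded U (fun k => sample (u k) M%:R^-1 (kap k) (f c))
      ((eta / 4 + V + N) / vol (fun _ : 'I_n => 2 * M%:R^-1))%R e UU e0.
    apply: filterS Uadm => k /= adm; rewrite -cx0.
    by apply: sample_bounded => //; [exact: ltW|exact: Hkap].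
  by exists a; apply: filterS Ha => k /= Hk _.
have [a Ha] := choice Hc.
exists [set k | admissible (u k) /\ forall c, (exists2 x, cubeK m x & corner M x = f c) ->
       (`|sample (u k) M%:R^-1 (kap k) (f c) - a c| <= e)%R].
  by apply: filterI => //; exact: filter_forall.
move=> k l [admk Hk] [adml Hl].
have mg j : admissible (u j) -> measurable_fun [set: n.-tuple R] (fun x =>
    (\1_(cubeK m) x * `|u j x - sample (u j) M%:R^-1 (kap j) (corner M x)|)%:E).
  move=> [mu _ _]; apply/measurable_EFinP; apply: measurable_funM; first exact: measurable_indic_cubeK.
  apply: (measurableT_comp (@normr_measurable R setT)).
  apply: measurable_funB => //.
  exact: (measurable_fun_pair2 (kap j) (measurable_sample_corner mu _ M)).
have mK : measurable_fun [set: n.-tuple R] (fun x => (\1_(cubeK m) x : R)%:E).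
  by apply/measurable_EFinP; exact: measurable_indic_cubeK.
have mk := mg _ admk; have ml := mg _ adml.
apply: (@le_trans _ _ (\int[lebn n]_x (((\1_(cubeK m) x *
   `|u k x - sample (u k) M%:R^-1 (kap k) (corner M x)|)%:E +
   (\1_(cubeK m) x * `|u l x - sample (u l) M%:R^-1 (kap l) (corner M x)|)%:E) +
   (2 * e)%:E * (\1_(cubeK m) x)%:E))).
  apply: ge0_le_integralT.
  - apply/measurable_EFinP; apply: measurable_funM; first exact: measurable_indic_cubeK.
    apply: (measurableT_comp (@normr_measurable R setT)).
    by have [? _ _] := admk; have [? _ _] := adml; exact: measurable_funB.
  - apply: emeasurable_funD; first exact: emeasurable_funD.
    by apply: emeasurable_funM => //; exact: measurable_cst.
  - by move=> x; rewrite lee_fin mulr_ge0.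
  move=> x; rewrite -EFinM -!EFinD lee_fin indicE.
  have [Kx|Kx] := pselect (cubeK m x); last first.
    by rewrite memNset// !mul0r mulr0 !addr0.
  rewrite mem_set// !mul1r mulr1.
  have [c cE] := Hf x Kx.
  have exc : exists2 x, cubeK m x & corner M x = f c by exists x.
  have := Hk c exc; have := Hl c exc; rewrite -cE.
  set sl := sample _ _ _ _; set sk := sample _ _ _ _ => hl hk.
  rewrite (_ : u k x - u l x = (u k x - sk) - (u l x - sl) + ((sk - a c) - (sl - a c)))%R; last by ring.
  apply: le_trans (ler_normD _ _) _; apply: lerD; first exact: ler_normB.
  apply: le_trans (ler_normB _ _) _; lra.
have m2 : measurable_fun [set: n.-tuple R] (fun x => (2 * e)%:E * (\1_(cubeK m) x)%:E).
  by apply: emeasurable_funM => //; exact: measurable_cst.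
have e20 : (0 <= 2 * e)%R by rewrite mulr_ge0// ltW.
rewrite ge0_integralTD//; last 3 first.
- exact: emeasurable_funD.
- by move=> x; rewrite adde_ge0// lee_fin mulr_ge0.
- by move=> x; rewrite mule_ge0// lee_fin.
rewrite ge0_integralTD//.
rewrite ge0_integralTZl// integral_cubeK//.
apply: (@le_trans _ _ ((eta / 4)%:E + (eta / 4)%:E + (eta / 2)%:E)).
  apply: leeD; first by apply: leeD; exact: Hkap.
  rewrite -EFinM lee_fin -/V /e.
  rewrite (_ : eta / 2 = 2 * (eta / (4 * (V + 1))) * (V + 1))%R; last by field; rewrite gt_eqF// ltr_wpDl.
  by apply: ler_wpM2l; [rewrite mulr_ge0// ltW|rewrite lerDl].
rewrite -!EFinD lee_fin; lra.
Qed.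

End sequence.
End cauchy.

(** * From L^1 to L^P, and extraction of a subsequence *)

Section subsequences.
Context {R : realType}.
Local Open Scope ereal_scope.

(** If |a| and |b| are at most L, then |a - b| <= 2L absorbs P - 1 of the powers. Otherwise the
    larger of the two exceeds L and |a - b| is at most twice it. *)
Lemma powR_sub_le (P L a b : R) : (1 <= P)%R -> (0 < L)%R ->
  (`|a - b| `^ P <= (2 * L) `^ (P - 1) * `|a - b| +
     2 `^ P * ((L < `|a|)%R%:R * `|a| `^ P + (L < `|b|)%R%:R * `|b| `^ P))%R.
Proof.
move=> P1 L0; have P0 : (0 < P)%R by apply: lt_le_trans P1.
have big (x y : R) : (L < `|x|)%R -> (`|y| <= `|x|)%R ->
    (`|x - y| `^ P <= 2 `^ P * `|x| `^ P)%R.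
  move=> Lx yx; rewrite -powRM//.
  apply: ge0_ler_powR; rewrite ?nnegrE ?mulr_ge0 ?(ltW P0)//.
  by apply: le_trans (ler_normB _ _) _; rewrite mulr_natl mulr2n lerD2l.
have t0 (x : R) : (0 <= (L < `|x|)%R%:R * `|x| `^ P)%R by rewrite mulr_ge0// powR_ge0.
have [La|aL] := ltP L `|a|%R.
  have [ba|ab] := leP `|b|%R `|a|%R.
    apply: ler_wpDl; first by rewrite mulr_ge0// powR_ge0.
    apply: le_trans (big _ _ La ba) _; apply: ler_wpM2l; first exact: powR_ge0.
    by rewrite mul1r lerDl.
  rewrite distrC; apply: ler_wpDl; first by rewrite mulr_ge0// powR_ge0.
  apply: le_trans (big _ _ (lt_trans La ab) (ltW ab)) _.
  apply: ler_wpM2l; first exact: powR_ge0.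
  by rewrite (lt_trans La ab) !mul1r lerDr powR_ge0.
have [Lb|bL] := ltP L `|b|%R.
  rewrite distrC; apply: ler_wpDl; first by rewrite mulr_ge0// powR_ge0.
  apply: le_trans (big _ _ Lb (le_trans aL (ltW Lb))) _.
  apply: ler_wpM2l; first exact: powR_ge0.
  by rewrite mul0r add0r mul1r.
rewrite !mul0r addr0 mulr0 addr0 -(mulr_powRB1 _ P0)// mulrC.
apply: ler_wpM2r => //; apply: ge0_ler_powR; rewrite ?nnegrE ?subr_ge0//.
  by rewrite mulr_ge0// ltW.
by apply: le_trans (ler_normB _ _) _; rewrite mulr_natl mulr2n lerD.
Qed.

Section LP.
Context {n : nat}.
Variables (p sig : 'I_n -> R) (C P N : R).
Hypotheses (C0 : (0 <= C)%R) (p1 : forall i, (1 < p i)%R).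
Hypotheses (sig0 : forall i, (0 < sig i)%R) (P1 : (1 <= P)%R).
Hypothesis tails : forall eta : R, (0 < eta)%R -> exists2 L : R, (0 < L)%R &
  forall u : n.-tuple R -> R, admissible p sig C P N u ->
    \int[lebn n]_x (\1_[set x | (L < `|u x|)%R] x * `|u x| `^ P)%:E <= eta%:E.

Lemma LP_cauchy (U : set_system nat) (u : nat -> n.-tuple R -> R) m (eta : R) :
  UltraFilter U -> U [set k | admissible p sig C P N (u k)] -> (0 < m)%N -> (0 < eta)%R ->
  exists2 S, U S & forall k l, S k -> S l ->
    \int[lebn n]_x (\1_(cubeK m) x * `|u k x - u l x| `^ P)%:E <= eta%:E.
Proof.
move=> UU Uadm m0 eta0; have UP : ProperFilter U by exact: ultra_proper.
have p20 : (0 < 2 `^ P :> R)%R by exact: powR_gt0.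
(* The two tails share eta/2 and fix [L]; the tolerance in L^1 comes after, since its factor
   (2L)^(P-1) depends on [L]. *)
have e10 : (0 < eta / (4 * 2 `^ P))%R by rewrite divr_gt0// mulr_gt0.
have [L L0 HL] := tails e10.
have pL0 : (0 < (2 * L) `^ (P - 1))%R by rewrite powR_gt0// mulr_gt0.
have e20 : (0 < eta / (2 * (2 * L) `^ (P - 1)))%R by rewrite divr_gt0// mulr_gt0.
have [S US HS] := L1_cauchy C0 p1 sig0 P1 UU Uadm m0 e20.
exists (S `&` [set k | admissible p sig C P N (u k)]); first exact: filterI.
move=> k l [Sk admk] [Sl adml].
have [mk _ _] := admk; have [ml _ _] := adml.
have mK : measurable_fun [set: n.-tuple R] (\1_(cubeK m) : n.-tuple R -> R).
  exact: measurable_indic_cubeK.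
have mT j : measurable_fun [set: n.-tuple R] (u j) ->
    measurable_fun [set: n.-tuple R]
      (fun x => (\1_[set x | (L < `|u j x|)%R] x * `|u j x| `^ P)%:E).
  move=> mj; apply/measurable_EFinP; apply: measurable_funM.
    by apply: measurable_indic; exact: measurable_superlevel.
  by have /measurable_EFinP := measurable_powR_norm P mj.
have mkl : measurable_fun [set: n.-tuple R] (fun x => u k x - u l x)%R.
  exact: measurable_funB.
have m1 : measurable_fun [set: n.-tuple R]
    (fun x => (\1_(cubeK m) x * `|u k x - u l x|)%:E).
  apply/measurable_EFinP; apply: measurable_funM => //.
  exact: (measurableT_comp (@normr_measurable R setT)).
have mTk := mT _ mk; have mTl := mT _ ml.
apply: (@le_trans _ _ (\int[lebn n]_x (((2 * L) `^ (P - 1))%:E *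
    (\1_(cubeK m) x * `|u k x - u l x|)%:E + (2 `^ P)%:E *
    ((\1_[set x | (L < `|u k x|)%R] x * `|u k x| `^ P)%:E +
    (\1_[set x | (L < `|u l x|)%R] x * `|u l x| `^ P)%:E)))).
  apply: ge0_le_integralT.
  - apply/measurable_EFinP; apply: measurable_funM => //.
    by have /measurable_EFinP := measurable_powR_norm P mkl.
  - apply: emeasurable_funD; apply: emeasurable_funM => //.
    exact: emeasurable_funD.
  - by move=> x; rewrite lee_fin mulr_ge0// powR_ge0.
  move=> x; rewrite -[X in _ + _ * X]EFinD -!EFinM -EFinD lee_fin.
  have indE j : \1_[set x | (L < `|u j x|)%R] x = (L < `|u j x|)%R%:R :> R.
    rewrite indicE; have [h|h] := boolP (L < `|u j x|)%R; first by rewrite mem_set.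
    by rewrite memNset//=; apply/negP.
  rewrite !indE [\1_(cubeK m) x]indicE.
  have [Kx|Kx] := pselect (cubeK m x).
    by rewrite mem_set// !mul1r; exact: powR_sub_le.
  by rewrite memNset// !mul0r mulr0 add0r mulr_ge0 ?addr_ge0 ?mulr_ge0 ?powR_ge0.
have mTT : measurable_fun [set: n.-tuple R] (fun x =>
    (\1_[set x | (L < `|u k x|)%R] x * `|u k x| `^ P)%:E +
    (\1_[set x | (L < `|u l x|)%R] x * `|u l x| `^ P)%:E).
  exact: emeasurable_funD.
have T0 j x : 0 <= (\1_[set x | (L < `|u j x|)%R] x * `|u j x| `^ P)%:E.
  by rewrite lee_fin mulr_ge0// powR_ge0.
rewrite ge0_integralTD; last 4 first.
- by apply: emeasurable_funM => //; exact: measurable_cst.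
- by apply: emeasurable_funM => //; exact: measurable_cst.
- by move=> x; rewrite mule_ge0// lee_fin ?mulr_ge0// ltW.
- by move=> x; rewrite mule_ge0 ?adde_ge0// lee_fin ltW.
rewrite ge0_integralTZl//; last exact: ltW.
rewrite ge0_integralTZl//; last by first [exact: ltW|move=> x; rewrite adde_ge0].
rewrite ge0_integralTD//.
apply: (@le_trans _ _ (((2 * L) `^ (P - 1))%:E * (eta / (2 * (2 * L) `^ (P - 1)))%:E +
   (2 `^ P)%:E * ((eta / (4 * 2 `^ P))%:E + (eta / (4 * 2 `^ P))%:E))).
  apply: leeD; apply: lee_wpmul2l; rewrite ?lee_fin ?powR_ge0//.
    exact: HS.
  by apply: leeD; exact: HL.
rewrite -[X in _ + _ * X]EFinD -!EFinM -EFinD lee_fin le_eqVlt; apply/orP; left; apply/eqP; field.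
by rewrite !gt_eqF.
Qed.

End LP.

(** Finite intersections of members are again members, and freeness makes them unbounded: [phi m] is
    picked in the intersection of [S 0], ..., [S m], beyond the previous index. *)
Lemma free_ultrafilter_selection (U : set_system nat) (S : nat -> set nat) :
  UltraFilter U -> (forall N, U [set k | (N <= k)%N]) -> (forall m, U (S m)) ->
  exists2 phi : nat -> nat, {homo phi : a b / (a < b)%N} &
    forall m i, (i <= m)%N -> S i (phi m).
Proof.
move=> UU Ufree US; have UP : ProperFilter U by exact: ultra_proper.
pose T m := [set k | forall i, (i <= m)%N -> S i k].
have UT m : U (T m).
  elim: m => [|m IH].
    by apply: filterS (US 0%N) => k Sk i; rewrite leqn0 => /eqP ->.
  apply: filterS (filterI IH (US m.+1)) => k [Tk Sk] i.
  by rewrite leq_eqVlt => /orP[/eqP ->//|]; rewrite ltnS; exact: Tk.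
have Hf (mN : nat * nat) : exists k, (mN.2 < k)%N /\ T mN.1 k.
  have [k [Tk Nk]] := filter_ex (filterI (UT mN.1) (Ufree mN.2.+1)).
  by exists k.
have [f Hff] := choice Hf.
pose phi := fix phi m := match m with 0%N => f (0, 0)%N | m'.+1 => f (m'.+1, phi m') end.
exists phi.
  apply: homo_ltn => [y x z xy yz|m]; first exact: ltn_trans xy yz.
  by have [] := Hff (m.+1, phi m).
move=> m; have Tm : T m (phi m).
  by case: m => [|m]; [have [] := Hff (0, 0)%N|have [] := Hff (m.+1, phi m)].
by move=> i; exact: Tm.
Qed.

Lemma limn_einf_le (f : nat -> \bar R) (c : \bar R) :
  (forall k, f k <= c) -> limn_einf f <= c.
Proof.
move=> fc; rewrite limn_einf_lim; apply: lime_le; first exact: is_cvg_einfs.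
apply: nearW => k; apply: le_trans (fc k); apply: ereal_inf_lbound.
by exists k => //=.
Qed.

Lemma limn_einf_ge (f : nat -> \bar R) (c : R) :
  (forall e : R, (0 < e)%R -> exists N, forall k, (N <= k)%N -> c%:E <= f k + e%:E) ->
  c%:E <= limn_einf f.
Proof.
move=> H; apply/lee_addgt0Pr => e e0; have [N HN] := H e e0.
rewrite -leeBlDr// limn_einf_lim; apply: lime_ge; first exact: is_cvg_einfs.
exists N => // k /= Nk; apply: le_ereal_inf_tmp => _ [l /= kl <-].
by rewrite EFinN leeBlDr//; apply: HN; exact: leq_trans kl.
Qed.

End subsequences.

(** * Almost everywhere limits *)

Section limits.
Context {R : realType}.
Local Open Scope ereal_scope.

Lemma boundedRn_cubeK n (K : set (n.-tuple R)) : boundedRn K ->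
  exists m0, forall m, (m0 <= m)%N -> K `<=` cubeK m.+1.
Proof.
move=> [r Hr]; exists (Num.truncn r).+1 => m m0m x Kx j.
have rm : (r < m.+1%:R)%R.
  have h : (r < (Num.truncn r).+1%:R)%R by exact: truncnS_gt.
  by apply: lt_le_trans h _; rewrite ler_nat ltnW.
have := Hr x Kx j; rewrite ler_norml => /andP[h1 h2].
by apply/andP; split; lra.
Qed.

Lemma cvg_of_summable_steps (a : nat -> R) (k0 : nat) (D : R) :
  (forall n, \sum_(k0 <= k < n) `|a k.+1 - a k| <= D)%R -> cvgn a.
Proof.
move=> HD.
have c1 : cvgn [normed series (telescope a)].
  apply: nondecreasing_is_cvgn.
    by apply: nondecreasing_series => k _ _; exact: normr_ge0.
  exists (\sum_(0 <= k < k0) `|a k.+1 - a k| + D)%R => _ [k _ <-] /=.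
  rewrite /series/= /telescope.
  have [kk|kk] := leqP k0 k.
    by rewrite (big_cat_nat (leq0n k0) kk)/= lerD2l.
  rewrite [X in (_ <= X + _)%R](big_cat_nat (leq0n k) (ltnW kk))/= -addrA.
  rewrite lerDl addr_ge0//; first by apply: sumr_ge0.
  by have := HD 0%N; rewrite big_geq.
have := normed_cvg c1; rewrite telescopeK => /cvg_ex[l Hl].
apply/cvg_ex; exists (l + a 0%N)%R.
have aE : ((fun k => a k - a 0%N) \+ cst (a 0%N))%R = a by apply/funext => k /=; rewrite subrK.
by rewrite -[X in X @ _]aE; apply: cvgD => //; exact: cvg_cst.
Qed.

(** The L^1 rate is summable because it must yield almost everywhere convergence, as in the
    Riesz-Fischer theorem; the L^P rate only has to vanish, since it is passed to the limit for each
    m separately. *)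
Lemma cauchy_limit n (P : R) (w : nat -> n.-tuple R -> R) : (1 <= P)%R ->
  (forall k, measurable_fun [set: n.-tuple R] (w k)) ->
  (forall m k l, (m <= k)%N -> (m <= l)%N ->
    \int[lebn n]_x (\1_(cubeK m.+1) x * `|w k x - w l x|)%:E <= (2^-1 ^+ m)%:E) ->
  (forall m k l, (m <= k)%N -> (m <= l)%N ->
    \int[lebn n]_x (\1_(cubeK m.+1) x * `|w k x - w l x| `^ P)%:E <= (m.+1%:R^-1)%:E) ->
  exists2 v : n.-tuple R -> R, measurable_fun [set: n.-tuple R] v &
    forall K, measurable K -> boundedRn K ->
    (fun m => intRn (fun x => (\1_K x * `|w m x - v x| `^ P)%:E)) @ \oo --> 0.
Proof.
move=> P1 mw H1 HP.
have P0 : (0 < P)%R by apply: lt_le_trans P1.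
(* The upper limit is defined and measurable everywhere; the points where the sequence diverges will
   form a null set. *)
pose v x := fine (limn_esup (fun k => (w k x)%:E)).
have mv : measurable_fun [set: n.-tuple R] v.
  apply: (measurableT_comp (f := fine)); first exact: fine_measurable.
  by apply: measurable_fun_limn_esup => k; exact/measurable_EFinP.
exists v => //.
have vE x : cvgn (w^~ x) -> w k x @[k --> \oo] --> v x.
  move=> cx; rewrite /v.
  have cE : (w k x)%:E @[k --> \oo] --> (limn (w^~ x))%:E by apply: cvg_EFin => //; exact: nearW.
  by rewrite (cvg_limn_einf_sup cE).2.
have mK m : measurable_fun [set: n.-tuple R] (\1_(cubeK m) : n.-tuple R -> R).
  exact: measurable_indic_cubeK.
have md k l : measurable_fun [set: n.-tuple R] (fun x => `|w k x - w l x|)%R.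
  apply: (measurableT_comp (@normr_measurable R setT)).
  exact: measurable_funB.
pose g k x : \bar R := (\1_(cubeK k.+1) x * `|w k x - w k.+1 x|)%:E.
have g0 k x : 0 <= g k x by rewrite lee_fin mulr_ge0.
have mg k : measurable_fun [set: n.-tuple R] (g k).
  by apply/measurable_EFinP; exact: measurable_funM.
pose D x := \sum_(k <oo) g k x.
have D0 x : 0 <= D x by apply: nneseries_ge0.
have mD : measurable_fun [set: n.-tuple R] D by exact: ge0_emeasurable_sum.
have Doo : \int[lebn n]_x D x < +oo.
  rewrite /D integral_nneseries//.
  apply: le_lt_trans (_ : _ <= \sum_(k <oo) (1 * 2^-1 ^+ k)%:E) _.
    apply: lee_nneseries => k _; first by move=> _; exact: integral_ge0.
    by rewrite mul1r; exact: H1.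
  apply: le_lt_trans (nneseries_geometric_le _ _) (ltry _) => //.
  by rewrite invr_ge0 ler0n/= invf_lt1// ltr1n.
have Dae : {ae lebn n, forall x, D x \is a fin_num}.
  have iD : (lebn n).-integrable setT D.
    apply/integrableP; split => //.
    by under eq_integral do rewrite gee0_abs//.
  by have := integrable_ae measurableT iD; apply: filterS => x /(_ Logic.I).
have Dcvg x : D x \is a fin_num -> cvgn (w^~ x).
  move=> Dx.
  (* The k-th difference is counted in [D] only on the cube of half-side k + 1, which contains the
     given point from [m0] on. *)
  have [m0 Hm0] : exists m0, forall m, (m0 <= m)%N -> [set x] `<=` cubeK m.+1.
    apply: boundedRn_cubeK; exists (\sum_(j < n) `|tnth x j|)%R => _ -> i.
    by rewrite (bigD1 i)//= lerDl sumr_ge0.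
  apply: (@cvg_of_summable_steps _ m0 (fine (D x))) => N.
  rewrite -lee_fin fineK// -sumEFin.
  apply: (@le_trans _ _ (\sum_(m0 <= k < N) g k x)).
    rewrite big_nat_cond [leRHS]big_nat_cond; apply: lee_sum => k /andP[/andP[mk _] _].
    by rewrite /g indicE mem_set ?mul1r 1?distrC//; exact: (Hm0 k mk x).
  have [Nm|mN] := leqP N m0; first by rewrite big_geq.
  apply: le_trans (nneseries_lim_ge N _) => //.
  by rewrite [leRHS](big_cat_nat (leq0n m0) (ltnW mN))/= leeDr// sume_ge0.
move=> K mKK bK; have [m0 Hm0] := boundedRn_cubeK bK.
have mIK : measurable_fun [set: n.-tuple R] (\1_K : n.-tuple R -> R).
  exact: measurable_indic.
have mF m : measurable_fun [set: n.-tuple R] (fun x => (\1_K x * `|w m x - v x| `^ P)%:E).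
  apply/measurable_EFinP; apply: measurable_funM => //.
  have mwv : measurable_fun [set: n.-tuple R] (fun x => w m x - v x)%R by exact: measurable_funB.
  by have /measurable_EFinP := measurable_powR_norm P mwv.
have F0 m x : 0 <= (\1_K x * `|w m x - v x| `^ P)%:E.
  by rewrite lee_fin mulr_ge0// powR_ge0.
have mf m l : measurable_fun [set: n.-tuple R] (fun x =>
    (2 `^ (P - 1))%:E * (\1_(cubeK m.+1) x * `|w m x - w (m + l)%N x| `^ P)%:E).
  apply: emeasurable_funM; first exact: measurable_cst.
  apply/measurable_EFinP; apply: measurable_funM => //.
  have mwv : measurable_fun [set: n.-tuple R] (fun x => w m x - w (m + l)%N x)%R by exact: measurable_funB.
  by have /measurable_EFinP := measurable_powR_norm P mwv.
have f0 m l x : 0 <= (2 `^ (P - 1))%:E * (\1_(cubeK m.+1) x * `|w m x - w (m + l)%N x| `^ P)%:E.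
  by rewrite mule_ge0// lee_fin ?mulr_ge0// powR_ge0.
have key m : (m0 <= m)%N ->
   \int[lebn n]_x (\1_K x * `|w m x - v x| `^ P)%:E <= (2 `^ (P - 1) * m.+1%:R^-1)%:E.
  move=> m0m.
  pose f l x := (2 `^ (P - 1))%:E * (\1_(cubeK m.+1) x * `|w m x - w (m + l)%N x| `^ P)%:E.
  have HF := @fatou _ _ R (lebn n) setT measurableT f (mf m) (fun l x _ => f0 m l x).
  apply: le_trans (le_trans HF _); last first.
    apply: limn_einf_le => l; rewrite /f ge0_integralTZl ?powR_ge0//.
    - rewrite EFinM; apply: lee_wpmul2l; first by rewrite lee_fin powR_ge0.
      by apply: HP => //; exact: leq_addr.
    - apply/measurable_EFinP; apply: measurable_funM => //.
      have mwv : measurable_fun [set: n.-tuple R] (fun x => w m x - w (m + l)%N x)%R by exact: measurable_funB.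
      by have /measurable_EFinP := measurable_powR_norm P mwv.
  (* The convexity inequality, at the price of the factor 2^(P-1), stands in for continuity of the
     power in the comparison with the lower limit. *)
  apply: ae_ge0_le_integral => //.
  - move=> x _; apply: limn_einf_ge => e e0; exists 0%N => k _.
    by rewrite adde_ge0 ?f0// lee_fin ltW.
  - apply: (measurableT_comp (f := @oppe R)) => //.
    apply: (measurable_fun_limn_esup (f := fun l x => - f l x)) => l.
    by apply: (measurableT_comp (f := @oppe R)) => //; exact: mf.
  apply: filterS Dae => x Dx _.
  have cx := vE x (Dcvg x Dx).
  apply: limn_einf_ge => e e0.
  (* Below 1 a distance dominates its P-th power, so a bound on the distance is enough. *)
  have e1 : (0 < Num.min 1 (e / 2 `^ (P - 1)))%R.
    by rewrite lt_min ltr01/= divr_gt0// powR_gt0.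
  have /cvgrPdist_lt/(_ _ e1)[N _ HN] := cx.
  exists N => l Nl; have := HN (m + l)%N (leq_trans Nl (leq_addl _ _)).
  rewrite /= lt_min => /andP[d1 d2].
  rewrite /f -EFinM -EFinD lee_fin indicE.
  have [Kx|Kx] := pselect (K x); last first.
    by rewrite memNset// mul0r addr_ge0 ?(ltW e0)// mulr_ge0 ?powR_ge0// mulr_ge0 ?powR_ge0.
  rewrite mem_set// mul1r indicE mem_set ?mul1r; last exact: Hm0 m0m _ Kx.
  rewrite (_ : w m x - v x = (w m x - w (m + l)%N x) + (w (m + l)%N x - v x))%R; last by ring.
  apply: le_trans (powR_normD_le _ _ P1) _; rewrite mulrDr lerD2l.
  rewrite mulrC -ler_pdivlMr ?powR_gt0//.
  apply: le_trans (ltW d2); rewrite distrC.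
  rewrite -[leRHS]powRr1//; have [->|d0] := eqVneq (v x - w (m + l)%N x)%R 0%R.
    by rewrite normr0 powR0 ?gt_eqF ?powR_ge0.
  by apply: ger_powR => //; rewrite normr_gt0 d0/= ltW.
apply: (@squeeze_cvge _ _ _ _ (cst 0) _ (fun m => (2 `^ (P - 1) * m.+1%:R^-1)%:E)).
- exists m0 => // m /= m0m; rewrite intRnE//; apply/andP; split.
    exact: integral_ge0.
  exact: key.
- exact: cvg_cst.
- apply: cvg_EFin; first exact: nearW.
  rewrite -[X in _ --> X](mulr0 (2 `^ (P - 1))%R).
  by apply: cvgMr; exact: cvg_harmonic.
Qed.

End limits.

(** * Subcritical exponents and conclusion *)

Section conclusion.
Context {R : realType}.

Lemma pmax_ge n (p : 'I_n -> R) i : p i <= pmax p.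
Proof. exact: le_bigmax. Qed.

(** Replacing s by t s divides A and B, the sums of 1/(s_i p_i) and 1/s_i, by t, so the last
    condition becomes q A - B < t P. Subcriticality is this inequality at q = P and t = 1, and it is
    open in q and t. *)
Lemma subcritical_exponents n (s p : 'I_n -> R) : (0 < n)%N ->
  (forall i, 0 < s i) -> (forall i, 1 < p i) ->
  spbar s p < n%:R -> pmax p < pstar s p ->
  exists sig q, [/\ forall i, 0 < sig i < s i, pmax p < q &
    \sum_(i < n) (q - p i) / (sig i * p i) < pmax p].
Proof.
move=> n0 s0 p1; have p0 i : 0 < p i by apply: lt_trans (p1 i).
have P0 : 0 < pmax p by apply: lt_le_trans (pmax_ge p (Ordinal n0)).
have nR : 0 < n%:R :> R by rewrite ltr0n.
set P := pmax p in P0 *.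
pose A := \sum_(i < n) (s i * p i)^-1; pose B := \sum_(i < n) (s i)^-1.
have sum0 (f : 'I_n -> R) : (forall i, 0 < f i) -> 0 < \sum_(i < n) f i.
  move=> f0; rewrite (bigD1 (Ordinal n0))//= ltr_pwDl// sumr_ge0// => i _.
  exact: ltW.
have A0 : 0 < A by apply: sum0 => i; rewrite invr_gt0 mulr_gt0.
have B0 : 0 < B by apply: sum0 => i; rewrite invr_gt0.
have spE : spbar s p = n%:R / A by rewrite /spbar -/A invfM invrK.
have sE : sbar s = n%:R / B by rewrite /sbar -/B invfM invrK.
rewrite /pstar spE sE ltr_pdivrMr// => nA.
have A1 : 1 < A by move: nA; rewrite ltr_pMr.
have -> : n%:R * (n%:R / A) / (n%:R / B) / (n%:R - n%:R / A) = B / (A - 1).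
  by field; rewrite !gt_eqF ?subr_gt0.
rewrite ltr_pdivlMr ?subr_gt0// => gap.
pose g := B - P * (A - 1).
have g0 : 0 < g by rewrite subr_gt0.
(* P (1 - t) uses at most half of the gap [g]; the minimum with 1/2 keeps t positive. *)
pose t := 1 - Num.min 2^-1 (g / (2 * P)).
have t0 : 0 < t.
  rewrite subr_gt0; apply: le_lt_trans (_ : 2^-1 < 1).
    by rewrite ge_min lexx.
  by rewrite invf_lt1// ltr1n.
have t1 : t < 1.
  rewrite ltrBlDr ltrDl lt_min invr_gt0 ltr0n/= divr_gt0// mulr_gt0//.
have tg : P * (A - t) < B.
  have : P * (1 - t) <= g / 2.
    rewrite /t opprB addrC subrK mulrC -ler_pdivlMr//.
    by rewrite ge_min; apply/orP; right; rewrite invfM mulrA.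
  by rewrite /g => h; lra.
have Pq : P < (P + B / t) / (A / t).
  rewrite ltr_pdivlMr ?divr_gt0// mulrA -(ltr_pM2r t0) mulrDl !divfK ?gt_eqF//.
  by lra.
(* Midpoint between P and the value of q at which q A/t - B/t equals P. *)
exists (fun i => t * s i), ((P + (P + B / t) / (A / t)) / 2); split.
- by move=> i; rewrite mulr_gt0//= gtr_pMl.
- by lra.
set q := (P + _) / 2.
have qA : q * (A / t) < P + B / t.
  by rewrite -ltr_pdivlMr ?divr_gt0// /q; lra.
apply: le_lt_trans (_ : q * (A / t) - B / t < P); last by lra.
rewrite le_eqVlt; apply/orP; left; apply/eqP.
rewrite /A /B !mulr_suml mulr_sumr -sumrB; apply: eq_bigr => i _.
by field; rewrite !gt_eqF.
Qed.

Local Open Scope ereal_scope.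

Lemma intRn_ge0 n (f : n.-tuple R -> \bar R) : (forall x, 0 <= f x) -> 0 <= intRn f.
Proof. by elim: n f => [|n IH] f f0 //=; apply: integral_ge0 => x _; exact: IH. Qed.

Lemma Jfrac_i_ge0 n (i : 'I_n) (s p : R) (u : n.-tuple R -> R) :
  (0 < s < 1)%R -> 0 <= Jfrac_i i s p u.
Proof.
move=> /andP[s0 s1]; apply: mule_ge0.
  by rewrite lee_fin mulr_ge0// ?subr_ge0 ltW.
apply: intRn_ge0 => x; apply: integral_ge0 => h _.
by rewrite lee_fin divr_ge0 ?powR_ge0.
Qed.

(** Since 1/s_i <= 1/sig_i and l <= 1, both the constant and the exponent of [diffp_dyadic] can be
    expressed by [sig]; summing over the directions gives one constant for all. *)
Lemma Jfrac_anisotropic_bound n (s p sig : 'I_n -> R) (u : n.-tuple R -> R) (M : R) :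
  measurable_fun [set: n.-tuple R] u ->
  (forall i, 0 < s i < 1)%R -> (forall i, 1 < p i)%R ->
  (forall i, 0 < sig i <= s i)%R -> (0 <= M)%R -> Jfrac s p u <= M%:E ->
  anisotropic_bound u p sig (\sum_(i < n) p i * (p i * M) / sig i)%R.
Proof.
move=> mu s01 p1 sigs M0 HJ i l /andP[l0 l1].
have p0 k : (0 < p k)%R by apply: lt_trans (p1 k).
have /andP[sig0 sigi] := sigs i.
have Ji : Jfrac_i i (s i) (p i) u <= (p i * M)%:E.
  have : ((p i)^-1)%:E * Jfrac_i i (s i) (p i) u <= M%:E.
    apply: le_trans HJ; rewrite /Jfrac (bigD1 i)//=.
    rewrite leeDl// sume_ge0// => k _; rewrite mule_ge0 ?Jfrac_i_ge0//.
    by rewrite lee_fin invr_ge0 ltW.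
  by rewrite muleC lee_pdivrMr// muleC EFinM muleC.
apply: le_trans (diffp_dyadic mu (s01 i) (ltW (p1 i)) l0 Ji) _.
have /andP[si0 _] := s01 i.
have pM k : (0 <= p k * (p k * M))%R by rewrite !mulr_ge0// ltW.
rewrite lee_fin; apply: ler_pM; rewrite ?powR_ge0 ?divr_ge0 ?(ltW si0)//.
  rewrite (bigD1 i)//= ler_wpDr//.
    apply: sumr_ge0 => k _; have /andP[sk0 _] := sigs k.
    by rewrite divr_ge0// ltW.
  by rewrite ler_wpM2l// lef_pV2 ?posrE.
apply: ger_powR; first by rewrite l0.
by rewrite lerD2l ler_pM2r.
Qed.

Lemma pint_le n (P M : R) (u : n.-tuple R -> R) : (0 < P)%R -> (0 <= M)%R ->
  pint P u < +oo -> Lpnorm P u <= M%:E -> pint P u <= (M `^ P)%:E.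
Proof.
move=> P0 M0; rewrite /Lpnorm.
have : 0 <= pint P u by apply: intRn_ge0 => x; rewrite lee_fin powR_ge0.
case: (pint P u) => [r| |]//; rewrite lee_fin => r0 _.
rewrite poweR_EFin !lee_fin => rM.
rewrite -[leLHS]powRr1// -(mulVf (lt0r_neq0 P0)) powRrM.
by apply: ge0_ler_powR; rewrite ?nnegrE ?powR_ge0 ?(ltW P0).
Qed.

Lemma admissible_tails n (p sig : 'I_n -> R) (C P N q eta : R) : (0 < n)%N ->
  (0 <= C)%R -> (forall i, 0 < p i <= P)%R -> (forall i, 0 < sig i)%R ->
  (0 <= N)%R -> (P < q)%R ->
  (\sum_(i < n) (q - p i) / (sig i * p i) < P)%R -> (0 < eta)%R ->
  exists2 L : R, (0 < L)%R & forall u : n.-tuple R -> R, admissible p sig C P N u ->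
    \int[lebn n]_x (\1_[set x | (L < `|u x|)%R] x * `|u x| `^ P)%:E <= eta%:E.
Proof.
move=> n0 C0 pP sig0 N0 Pq subP eta0.
have p0 i : (0 < p i)%R by have /andP[] := pP i.
have P0 : (0 < P)%R by have /andP[h1 h2] := pP (Ordinal n0); exact: lt_le_trans h2.
set E := (\sum_(i < n) _)%R in subP.
have PE : (0 < P - E)%R by rewrite subr_gt0.
pose X := (2 * N * 2 ^+ n)%R.
have X0 : (0 <= X)%R by rewrite !mulr_ge0.
pose K := (4 * C * (\sum_(i < n) n%:R `^ p i))%R.
have K0 : (0 <= K)%R by rewrite !mulr_ge0// sumr_ge0// => i _; exact: powR_ge0.
(* Above the threshold X^(1/(P-E)) one has 2 N 2^n <= la^(P-E), which is the condition on [la] in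
   [weak_type]. *)
have [L L0 HL] := uniform_tail (Num.max 1 (X `^ (P - E)^-1))%R P0 Pq K0 eta0.
exists L => // u [mu Hu HN]; apply: HL => // la; rewrite ge_max => /andP[la1 laX].
have la0 : (0 < la)%R by apply: lt_le_trans la1.
apply: (weak_type mu Hu) HN _ => //.
  by move=> i; have /andP[_ h] := pP i; apply: le_trans h (ltW Pq).
rewrite -/E.
have XE : (X <= la `^ (P - E))%R.
  rewrite -[leLHS]powRr1// -(mulVf (lt0r_neq0 PE)) powRrM.
  by apply: ge0_ler_powR; rewrite ?nnegrE ?powR_ge0 ?(ltW PE) ?(ltW la0).
rewrite exprVn mulrC -[leRHS]mulrC -ler_pdivrMr// invrK.
rewrite (_ : - E = - P + (P - E))%R; last by lra.
rewrite powRD; last by rewrite (gt_eqF la0) implybT.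
by rewrite -mulrA; apply: ler_wpM2l; [exact: powR_ge0|].
Qed.

End conclusion.

Theorem theorem3p3 (R : realType) (n : nat) (p : 'I_n -> R) (j : nat)
    (stail : 'I_n -> R) (s : nat -> 'I_n -> R) (u : nat -> n.-tuple R -> R) :
  (forall i, 1 < p i) ->
  (1 <= j <= n)%N ->
  (forall i : 'I_n, (j <= i)%N -> 0 < stail i < 1) ->
  (forall (k : nat) (i : 'I_n), (j <= i)%N -> s k i = stail i) ->
  (forall (k : nat) (i : 'I_n), (i < j)%N -> 0 < s k i < 1) ->
  (forall i : 'I_n, (i < j)%N -> (fun k => s k i) @ \oo --> (1 : R)) ->
  (forall k, measurable_fun [set: n.-tuple R] (u k)) ->
  (forall k, (pint (pmin p) (u k) < +oo)%E /\ (pint (pmax p) (u k) < +oo)%E) ->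
  (exists M : R, forall k, (Lpnorm (pmax p) (u k) + Lpnorm (pmin p) (u k) <= M%:E)%E) ->
  (exists M : R, forall k, (Jfrac (s k) p (u k) <= M%:E)%E) ->
  let s0 := fun i : 'I_n => if (i < j)%N then 1 else stail i in
  spbar s0 p < n%:R ->
  pmax p < pstar s0 p ->
  exists (phi : nat -> nat) (v : n.-tuple R -> R),
    {homo phi : a b / (a < b)%N} /\
    measurable_fun [set: n.-tuple R] v /\
    forall K : set (n.-tuple R), measurable K -> boundedRn K ->
      (fun m => intRn (fun x => (\1_K x * `|u (phi m) x - v x| `^ pmax p)%:E))
        @ \oo --> 0%E.
Proof.
move=> p1 /andP[j1 jn] tail01 tailE head01 head1 mu ufin [M1 HM1] [M2 HM2] s0 spn Pstar.
have n0 : (0 < n)%N by exact: leq_trans jn.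
have s00 i : 0 < s0 i.
  by rewrite /s0; case: ltnP => // ji; have /andP[] := tail01 i ji.
have s01 k i : 0 < s k i < 1.
  by have [ij|ji] := ltnP i j; [exact: head01|rewrite tailE//; exact: tail01].
have [sig [q [sigs Pq subP]]] := subcritical_exponents n0 s00 p1 spn Pstar.
have pP i : p i <= pmax p by exact: pmax_ge.
have P1 : 1 < pmax p by apply: lt_le_trans (pP (Ordinal n0)).
have sig0 i : 0 < sig i by have /andP[] := sigs i.
set P := pmax p in Pstar Pq subP pP P1 *.
have P0 : 0 < P by apply: lt_trans P1.
pose C := \sum_(i < n) p i * (p i * `|M2|) / sig i.
pose N := `|M1| `^ P.
have C0 : 0 <= C.
  apply: sumr_ge0 => i _; have pi0 : 0 < p i by apply: lt_trans (p1 i).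
  by rewrite divr_ge0 ?mulr_ge0// ltW.
(* Only for late k, because [s k i] exceeds [sig i] only once it is close to its limit. *)
have adm : \forall k \near \oo, admissible p sig C P N (u k).
  have sigk : \forall k \near \oo, forall i, sig i < s k i.
    apply: filter_forall => i; have /andP[_ sigi] := sigs i.
    have [ij|ji] := ltnP i j.
      by apply: cvgr_gt (head1 i ij) _ _; move: sigi; rewrite /s0 ij.
    by apply: nearW => k; rewrite tailE//; move: sigi; rewrite /s0 ltnNge ji.
  apply: filterS sigk => k sigk; split => //.
    apply: (@Jfrac_anisotropic_bound _ _ (s k)) => //.
      by move=> i; rewrite sig0 ltW.
    by apply: le_trans (HM2 k) _; rewrite lee_fin ler_norm.
  apply: pint_le => //; first by have [] := ufin k.
  apply: (@le_trans _ _ M1%:E); last by rewrite lee_fin ler_norm.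
  by apply: le_trans (HM1 k); rewrite leeDl// poweR_ge0.
(* Being finer than the eventuality filter, [U] contains every property of late indices and is
   free. *)
have [U [UU ooU]] := ultraFilterLemma (eventually_filter : ProperFilter \oo).
have Uadm : U [set k | admissible p sig C P N (u k)] by exact: ooU.
have tails eta : 0 < eta -> exists2 L : R, 0 < L &
    forall w : n.-tuple R -> R, admissible p sig C P N w ->
    (\int[lebn n]_x (\1_[set x | (L < `|w x|)%R] x * `|w x| `^ P)%:E <= eta%:E)%E.
  apply: admissible_tails n0 C0 _ sig0 _ Pq subP => //; last exact: powR_ge0.
  by move=> i; rewrite pP (lt_trans _ (p1 i)).
have Hex m : exists S : set nat, U S /\ forall k l, S k -> S l ->
    (\int[lebn n]_x (\1_(cubeK m.+1) x * `|u k x - u l x|)%:E <= (2^-1 ^+ m)%:E)%E /\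
    (\int[lebn n]_x (\1_(cubeK m.+1) x * `|u k x - u l x| `^ P)%:E <= (m.+1%:R^-1)%:E)%E.
  have e0 : 0 < 2^-1 ^+ m :> R by rewrite exprn_gt0// invr_gt0.
  have [S1 US1 H1] := L1_cauchy C0 p1 sig0 (ltW P1) UU Uadm (ltn0Sn m) e0.
  have e1 : 0 < m.+1%:R^-1 :> R by rewrite invr_gt0.
  have [S2 US2 H2] := LP_cauchy C0 p1 sig0 (ltW P1) tails UU Uadm (ltn0Sn m) e1.
  have UP : ProperFilter U by exact: ultra_proper.
  exists (S1 `&` S2); split; first exact: filterI.
  by move=> k l [? ?] [? ?]; split; [exact: H1|exact: H2].
have [S HS] := choice Hex.
have Ufree m : U [set k | (m <= k)%N] by apply: ooU; exists m.
have [phi phi_incr Sphi] := free_ultrafilter_selection UU Ufree (fun m => (HS m).1).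
have [|||v mv Hv] := @cauchy_limit _ n P (fun m => u (phi m)) (ltW P1).
- by move=> k; exact: mu.
- by move=> m k l mk ml; have [] := (HS m).2 _ _ (Sphi _ _ mk) (Sphi _ _ ml).
- by move=> m k l mk ml; have [] := (HS m).2 _ _ (Sphi _ _ mk) (Sphi _ _ ml).
by exists phi, v.
Qed.
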